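(* Let $R$ be smooth and of essentially finite type over $k$, and let $\{A_{k,n}\}_{k\ge 0,\,0\le n\le q-1}$ be a family of matrices in $M_l(R)$ with only finitely many nonzero. Then the set of (extended) jumping numbers of $\{A_{k,n}\}$ is a discrete set of rational numbers.
   Context: $k$ (as a field) is perfect of characteristic $p>0$, $q$ is a power of $p$, and $R$ is a regular Noetherian commutative $k$-algebra whose Frobenius is finite. For a submodule $N\subset R^{\oplus a}$, $N^{[q^e]}$ is the submodule generated by the vectors $(n_1^{q^e},\dots,n_a^{q^e})$ with $(n_1,\dots,n_a)\in N$, and $N^{[1/q^e]}$ is the smallest submodule $N'$ with $N\subset N'^{[q^e]}$. List test modules. Set $H^1_n(\tau)=\sum_kA_{k,n}\tau^k$ and $A(t)=\sum_{0\le n<q}H^1_n(t^q)t^n\in M_l(R[t])$. For a matrix $B$ over $R[t]$, $B^{[q^i]}$ is the matrix of $q^i$-th powers of the entries. Put $A(t)^{e}=A(t)^{[q^{e}]}\cdots A(t)^{[q]}A(t)$ and define $H^e_n(\tau)\in M_l(R)[\tau]$ as the unique polynomials with $A(t)^{e-1}=\sum_{0\le n\le q^e-1}H^e_n(t^{q^e})t^n$. There is a minimal $N$ such that all $H^e_n(\tau)$ have degree $\le N$ in $\tau$. For $e\ge0$ and $\lambda\in(0,1]$ the list test module is $$\tau(\{A_{k,n}\},\lambda,e)=\sum_{0<\lambda'\le\lambda}\left(H^{e+1}_{\lceil\lambda'q^{e+1}\rceil-1}(\tau)R^{\oplus l}\right)^{[1/q^{e+1}]}\subset R^{\oplus l}\oplus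 R^{\oplus l}\tau\oplus\cdots\oplus R^{\oplus l}\tau^N .$$ Jumping numbers. $S_e=\{\lambda\in(0,1): \tau(\{A_{k,n}\},\lambda',e)\ne\tau(\{A_{k,n}\},\lambda,e)\ \text{for all } 1\ge\lambda'>\lambda\}$. A real number is an accumulation point of $\{S_e\}$ if it lies in $\bigcap_{e'}\overline{\bigcup_{e\ge e'}S_e}$. A jumping number of $\{A_{k,n}\}$ is a non-zero accumulation point of $\{S_e\}$; an extended jumping number is a real number having an integer translate that is a jumping number. *)

(* Defs.v *)
From HB Require Import structures.
From mathcomp Require Import all_boot all_order all_algebra.
From mathcomp Require Import zify.
From mathcomp Require Import all_classical all_reals all_analysis.
Import numFieldNormedType.Exports.

Set Implicit Arguments.
Unset Strict Implicit.
Unset Printing Implicit Defensive.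

Import Order.TTheory GRing.Theory Num.Theory.

Local Open Scope classical_set_scope.
Local Open Scope ring_scope.

Section Algebras.
Variable k : fieldType.

Definition perfect_of_char (p : nat) : Prop :=
  p \in [pchar k] /\ forall x : k, exists y : k, y ^+ p = x.

Definition finitely_generated (B : comAlgType k) : Prop :=
  exists s : seq B, forall C : {pred B},
    subalg_closed C -> {subset s <= C} -> forall b : B, b \in C.

Definition is_localization (B R : comAlgType k) (S : {pred B})
    (f : {lrmorphism B -> R}) : Prop :=
  [/\ mulr_closed S,
      forall s, s \in S -> exists u : R, u * f s = 1,
      forall r : R, exists b s, s \in S /\ r * f s = f b
    & forall b, f b = 0 -> exists s, s \in S /\ s * b = 0].

Definition essentially_of_finite_type (R : comAlgType k) : Prop :=
  exists (B : comAlgType k) (S : {pred B}) (f : {lrmorphism B -> R}),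
    finitely_generated B /\ is_localization S f.

(* The infinitesimal lifting property (EGA 0_IV, 19.3.1, discrete topologies):
   the square-zero ideal is the kernel of the surjection pi.  An algebra
   essentially of finite type over k is smooth over k iff it satisfies it. *)
Definition formally_smooth (R : comAlgType k) : Prop :=
  forall (C D : comAlgType k) (pi : {lrmorphism C -> D}),
    (forall d : D, exists c : C, pi c = d) ->
    (forall x y : C, pi x = 0 -> pi y = 0 -> x * y = 0) ->
    forall g : {lrmorphism R -> D},
      exists h : {lrmorphism R -> C}, forall r : R, pi (h r) = g r.

Definition smooth_eft (R : comAlgType k) : Prop :=
  essentially_of_finite_type R /\ formally_smooth R.

End Algebras.

(* Submodules of the free module of m x n matrices over R. *)
Section FrobeniusPowers.
Variables (R : comNzRingType) (m n : nat).
Implicit Types N : set 'M[R]_(m, n).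

Definition submodule N : Prop := submod_closed [in N].

Definition bracket_mx (d : nat) (v : 'M[R]_(m, n)) : 'M[R]_(m, n) :=
  map_mx (fun x : R => x ^+ d) v.

(* N^{[d]}, used with d = q ^ e *)
Definition bracket_power (d : nat) N : set 'M[R]_(m, n) :=
  smallest submodule (bracket_mx d @` N).

(* N^{[1/d]}, used with d = q ^ e: the intersection of all the submodules N'
   such that N is contained in N'^{[d]}; it is the smallest one of them
   whenever there is a smallest one. *)
Definition bracket_root (d : nat) N : set 'M[R]_(m, n) :=
  \bigcap_(N' in [set N' | submodule N' /\ N `<=` bracket_power d N']) N'.

End FrobeniusPowers.

(* Matrices in M_l(R[t]) and M_l(R)[tau] are represented by matrices with
   coefficients in {poly R}. *)
Section ListTestModules.
Variables (R : comNzRingType) (q l : nat) (A : nat -> 'I_q -> 'M[R]_l).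

Definition list_gen (n : 'I_q) : 'M[{poly R}]_l :=
  \sum_(k \in [set: nat]) ('X^k *: map_mx polyC (A k n)).

Definition list_mx : 'M[{poly R}]_l :=
  \sum_(n < q) ('X^n *: map_mx (fun h : {poly R} => h \Po 'X^q) (list_gen n)).

(* A(t)^e = A(t)^{[q^e]} ... A(t)^{[q]} A(t) *)
Fixpoint list_pow (e : nat) : 'M[{poly R}]_l :=
  if e is e'.+1 then bracket_mx (q ^ e) list_mx *m list_pow e' else list_mx.

(* H^e_n(tau), for 0 < e and n < q ^ e; see list_polyE and list_poly_uniq. *)
Definition list_poly (e n : nat) : 'M[{poly R}]_l :=
  map_mx (fun h : {poly R} => \poly_(i < size h) h`_(i * q ^ e + n))
    (list_pow e.-1).

Definition list_degree_bound (N : nat) : Prop :=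
  forall e n, (0 < e)%N -> (n < q ^ e)%N ->
    forall i j, (size (list_poly e n i j) <= N.+1)%N.

(* The minimal N such that all the H^e_n have degree at most N; it exists as
   soon as 1 < q, see list_degreeP. *)
Definition list_degree : nat :=
  xget 0%N [set N | list_degree_bound N /\
                    forall N', list_degree_bound N' -> (N <= N')%N].

(* H(tau) R^l inside R^l + R^l tau + ... + R^l tau^N: the j-th column of the
   matrix is the coefficient of tau^j. *)
Definition list_image (N : nat) (H : 'M[{poly R}]_l) : set 'M[R]_(l, N.+1) :=
  [set \matrix_(i, j) ((H *m map_mx polyC v) i 0)`_j | v in [set: 'cV[R]_l]].

Section RealExponents.
Variable RR : realType.
Implicit Types lambda : RR.

Definition list_test_module lambda (e : nat) :
    set 'M[R]_(l, list_degree.+1) :=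
  smallest (@submodule R l list_degree.+1)
    (\bigcup_(mu in [set mu : RR | 0 < mu <= lambda])
       bracket_root (q ^ e.+1)
         (list_image
            (list_poly e.+1 (`|Num.ceil (mu * (q ^ e.+1)%:R)|%N.-1)))).

Definition list_jumps (e : nat) : set RR :=
  [set lambda | 0 < lambda < 1 /\
     forall lambda', lambda < lambda' <= 1 ->
       list_test_module lambda' e <> list_test_module lambda e].

Definition accumulation_points (S : nat -> set RR) : set RR :=
  \bigcap_e' closure (\bigcup_(e in [set e | (e' <= e)%N]) S e).

Definition jumping_numbers : set RR :=
  accumulation_points list_jumps `\ 0.

Definition extended_jumping_numbers : set RR :=
  [set x | exists z : int, jumping_numbers (x + z%:~R)].

End RealExponents.
End ListTestModules.

Arguments jumping_numbers {R q l} A RR.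
Arguments extended_jumping_numbers {R q l} A RR.

(* Discreteness in the usual sense for jumping numbers: no accumulation point
   in the whole real line, i.e. finitely many elements in each bounded
   interval.  In particular every point is isolated. *)
Definition discrete_subset (RR : realType) (J : set RR) : Prop :=
  limit_point J = set0.

Section ListPolyTheory.
Variables (R : comNzRingType) (q l : nat) (A : nat -> 'I_q -> 'M[R]_l).

Lemma coef_sum_digits (d : nat) (G : nat -> {poly R}) (m : nat) :
  (0 < d)%N ->
  (\sum_(n < d) 'X^n * (G n \Po 'X^d))`_m = (G (m %% d)%N)`_(m %/ d).
Proof.
move=> d0; rewrite coef_sum.
have md : (m %% d < d)%N by rewrite ltn_mod.
rewrite (bigD1 (Ordinal md)) //= big1 ?addr0.
  rewrite coefXnM comp_poly_Xn // ltnNge leq_mod /= coef_poly.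
  have -> : (m - m %% d = m %/ d * d)%N by rewrite {1}(divn_eq m d) addnK.
  rewrite dvdn_mull // mulnK //; case: ltnP => // h.
  by rewrite nth_default // -(leq_pmul2r d0).
move=> n nm; rewrite coefXnM comp_poly_Xn // coef_poly.
case: ltnP => // nlem; case: ifP => // _; case: ifP => // dv.
case/eqP: nm; apply/val_inj => /=.
rewrite -(modn_small (ltn_ord n)); apply/esym/eqP.
by rewrite eqn_mod_dvd.
Qed.

Lemma digit_sum_coef (d : nat) (H : nat -> 'M[{poly R}]_l) i j m :
  (0 < d)%N ->
  ((\sum_(n < d) 'X^n *: map_mx (fun h : {poly R} => h \Po 'X^d) (H n)) i j)`_m
  = (H (m %% d)%N i j)`_(m %/ d).
Proof.
move=> d0; rewrite -(coef_sum_digits (fun n => H n i j)) // summxE.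
by congr (nth 0 (polyseq _) m); apply: eq_bigr => n _; rewrite !mxE.
Qed.

Lemma list_poly_coef (e n : nat) i j m : (1 < q)%N ->
  (list_poly A e n i j)`_m = (list_pow A e.-1 i j)`_(m * q ^ e + n).
Proof.
move=> q1; rewrite mxE coef_poly; case: ltnP => // h.
rewrite nth_default //; apply: (leq_trans h); apply: leq_trans (leq_addr _ _).
by rewrite leq_pmulr // expn_gt0 (ltnW q1).
Qed.

(* A(t)^{e-1} = \sum_n H^e_n(t^{q^e}) t^n, with e.+1 for e. *)
Lemma list_polyE (e : nat) : (1 < q)%N ->
  list_pow A e =
  \sum_(n < q ^ e.+1)
    'X^n *: map_mx (fun h : {poly R} => h \Po 'X^(q ^ e.+1))
                   (list_poly A e.+1 n).
Proof.
move=> q1; apply/matrixP => i j; apply/polyP => m.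
rewrite digit_sum_coef ?expn_gt0 ?(ltnW q1) //.
by rewrite list_poly_coef //= -divn_eq.
Qed.

Lemma list_poly_uniq (e : nat) (H : nat -> 'M[{poly R}]_l) : (1 < q)%N ->
  list_pow A e =
  \sum_(n < q ^ e.+1)
    'X^n *: map_mx (fun h : {poly R} => h \Po 'X^(q ^ e.+1)) (H n) ->
  forall n, (n < q ^ e.+1)%N -> H n = list_poly A e.+1 n.
Proof.
move=> q1 HE n nlt; apply/matrixP => i j; apply/polyP => m.
have d0 : (0 < q ^ e.+1)%N by rewrite expn_gt0 (ltnW q1).
rewrite list_poly_coef //= HE digit_sum_coef //.
by rewrite modnMDl modn_small // divnMDl // divn_small // addn0.
Qed.

Lemma list_degree_bounded : (1 < q)%N -> exists N, list_degree_bound A N.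
Proof.
move=> q1.
pose D := \max_(i < l) \max_(j < l) (size (list_mx A i j)).
have DP i j : (size (list_mx A i j) <= D.+1)%N.
  apply: leqW; apply: leq_trans (leq_bigmax (F := fun i : 'I_l =>
    (\max_(j < l) size (list_mx A i j))%N) i).
  exact: (leq_bigmax (F := fun j : 'I_l => size (list_mx A i j)) j).
have powP e i j : (size (list_pow A e i j) <= (D * (q ^ e.+1 - 1)).+1)%N.
  elim: e i j => [|e IH] i j /=.
    apply: (leq_trans (DP i j)); rewrite ltnS expn1 leq_pmulr //.
    by rewrite subn_gt0.
  rewrite mxE; apply: (leq_trans (size_sum _ _ _)); apply/bigmax_leqP => r _.
  apply: (leq_trans (size_polyMleq _ _)).
  have h1 : (size ((bracket_mx (q ^ e.+1) (list_mx A)) i r)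
               <= (D * q ^ e.+1).+1)%N.
    rewrite mxE; apply: (leq_trans (size_poly_exp_leq _ _)).
    by rewrite ltnS leq_mul2r; apply/orP; right; rewrite -subn1 leq_subLR add1n DP.
  have h2 := IH r j.
  have h3 : (2 * q ^ e.+1 <= q ^ e.+2)%N.
    by rewrite [(q ^ e.+2)%N]expnS leq_mul2r q1 orbT.
  have h4 : (0 < q ^ e.+1)%N by rewrite expn_gt0 (ltnW q1).
  have h5 : (D * q ^ e.+1 + D * (q ^ e.+1 - 1) <= D * (q ^ e.+2 - 1))%N.
    rewrite -mulnDr leq_mul2l; apply/orP; right.
    by move: h3 h4; set Q1 := (q ^ e.+1)%N; set Q2 := (q ^ e.+2)%N; clearbody Q1 Q2; lia.
  rewrite -subn1 leq_subLR (leq_trans (leq_add h1 h2)) //.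
  by rewrite addSn addnS add1n !ltnS.
exists D => -[//|e] n _ _ i j.
apply/leq_sizeP => m Dm; rewrite list_poly_coef //=.
rewrite nth_default //; apply: (leq_trans (powP e i j)).
have h4 : (0 < q ^ e.+1)%N by rewrite expn_gt0 (ltnW q1).
have : (D * (q ^ e.+1 - 1) <= D * q ^ e.+1)%N by rewrite leq_mul2l leq_subr orbT.
have : (D.+1 * q ^ e.+1 <= m * q ^ e.+1)%N by rewrite leq_mul2r Dm orbT.
by rewrite mulSn; lia.
Qed.

Lemma list_degreeP : (1 < q)%N ->
  list_degree_bound A (list_degree A) /\
  forall N, list_degree_bound A N -> (list_degree A <= N)%N.
Proof.
move=> q1; have [N0 N0P] := list_degree_bounded q1.
pose P := [pred N | `[< list_degree_bound A N >]].
have exP : exists N, P N by exists N0; apply/asboolP.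
rewrite /list_degree; case: xgetP => [_ _ //|/= noN].
case: (ex_minnP exP) => N /asboolP NP minN.
exfalso; apply: (noN N); split=> // N' N'P.
by apply: minN; apply/asboolP.
Qed.

End ListPolyTheory.

(* Main.v *)
Require Import Defs.
From HB Require Import structures.
From mathcomp Require Import all_boot all_order all_algebra all_field perm.
From mathcomp Require Import zify lra.
From mathcomp Require Import all_classical all_reals all_analysis.

(** Let A(t) be the matrix of the list and let L_r be the R-linear map of
R^l + R^l tau + ... + R^l tau^N that multiplies by A(t) and keeps the powers
of t congruent to r modulo q.  The recursion for A(t)^e reads
H^{e+1}_{n + r q^e} = L_r^{[q^e]} H^e_n, and flatness of the Frobenius turns it
into M^{e+1}_{n + r q^e} = (L_r M^e_n)^{[1/q]} for
M^e_n = (H^e_n R^l)^{[1/q^e]}.  Thus M^e_n arises from R^l by applying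
operators along the q-adic digits of n, the lowest digit first
([list_root_words]), and an exponent jumps at a level only if it is n/q^e for
an n with M^e_n not contained in the sum of the M^e_n', n' < n
([list_jump_module]).

Two facts make this finite dimensional.
- A Frobenius dual basis ([smooth_dual_basis]): operators phi_t with
  phi_t (r^q x) = r phi_t x, and elements b_t, with
  x = sum_t phi_t(x)^q b_t.  If R is a localization of k[s_1, ..., s_n], the
  ring E = R[X_i]/(X_i^q - s_i) is free over R and maps onto R by r |-> r^q,
  X_i |-> s_i.  The kernel is nil, hence nilpotent as E is noetherian; formal
  smoothness lifts the identity of R to R -> E, and the phi_t are the
  coordinates of the lift.  Roots N^{[1/q]} are then computed by the phi_t, so
  M^e_n is spanned by words in finitely many q^-1-linear operators.
- Contraction ([contraction]): such operators divide degrees by q up to a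
  constant, so finitely many of them preserve a finite dimensional k-space.
Every jump of the M^e_n is therefore a jump of k-spaces spanned by words in
q^-1-linear operators of a fixed space k^X ([module_jump_word]).

At each level there are at most #|X| jumps, but the levels are not related in
a periodic way when k is infinite: the span S_e of all words of length e may
wander among the subspaces of k^X forever.  The heart of the proof is that
nevertheless the first m digits of the jumps, taken over all levels, assume a
number of values that is bounded independently of m ([jumps_bounded]).  The
digits in question depend only on which tuples of words of length m are
linearly independent on vectors of S_e, hence on which multilinear forms with
coefficients in F vanish on S_e, where F is the subfield of k generated by
the finitely many matrix entries.  The field F is finitely generated over the
finite field F_p, so the contraction principle, applied to F over F_p, shows
that the annihilators of the tensor powers of S_e over F take only finitely
many values ([annihilators_finite], [multi_annihilators_finite]).

A uniform bound on the m-digit truncations leaves only finitely many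
accumulation points ([acc_card]).  Dropping the top digit of a jump gives a
jump ([word_jump_low]), so the finite set of accumulation points is stable
under suitable maps x |-> q x - r, and its elements are rational
([acc_rational]). *)

Set Implicit Arguments.
Unset Strict Implicit.
Unset Printing Implicit Defensive.

Import Order.TTheory GRing.Theory Num.Theory.
Import numFieldNormedType.Exports.

Local Open Scope ring_scope.


(** * Monomials, presentations and the contraction principle *)

(** The only consequence of positive characteristic that most arguments use.
   *)
Definition qth_power_additive (R : nzRingType) (q : nat) : Prop :=
  forall x y : R, (x + y) ^+ q = x ^+ q + y ^+ q.

(** Also known as Cartier maps, or as R-linear maps to R from R with scalars
   restricted along x |-> x^q. *)
Definition inv_frob_linear (R : nzRingType) (q : nat) (psi : R -> R) : Prop :=
  (forall x y, psi (x + y) = psi x + psi y) /\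
  (forall r x, psi (r ^+ q * x) = r * psi x).

Section InvFrob.
Variables (R : nzRingType) (q : nat) (psi : R -> R).
Hypothesis psiP : inv_frob_linear q psi.

Lemma inv_frob0 : psi 0 = 0.
Proof. by apply: (@addrI _ (psi 0)); rewrite -psiP.1 !addr0. Qed.

Lemma inv_frob_sum (T : Type) (r : seq T) (P : pred T) (F : T -> R) :
  psi (\sum_(i <- r | P i) F i) = \sum_(i <- r | P i) psi (F i).
Proof. exact: (big_morph psi psiP.1 inv_frob0). Qed.

End InvFrob.

Section QPower.
Variables (R : nzRingType) (q : nat).
Hypotheses (q0 : (0 < q)%N) (Rq : qth_power_additive R q).

Lemma qth_power_sum (T : Type) (r : seq T) (P : pred T) (F : T -> R) :
  (\sum_(i <- r | P i) F i) ^+ q = \sum_(i <- r | P i) F i ^+ q.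
Proof.
apply: (big_morph (fun x : R => x ^+ q) Rq).
by rewrite expr0n eqn0Ngt q0.
Qed.

End QPower.

Section Box.
Variables (K : fieldType) (R : comNzRingType) (iota : {rmorphism K -> R}).

Section Family.
Variables (I : finType) (s : I -> R).

Definition mono (g : I -> nat) : R := \prod_i s i ^+ g i.

(** The filtration bounds each exponent separately, not the total degree, so
   that division with remainder by q can be done exponent by exponent
   ([mono_digits]). *)
Definition box (d : nat) (x : R) : Prop :=
  exists c : {ffun I -> 'I_d.+1} -> K,
    x = \sum_g iota (c g) * mono (fun i => g i).

Definition in_alg_of (x : R) : Prop := exists d, box d x.

Lemma monoD g1 g2 : mono g1 * mono g2 = mono (fun i => (g1 i + g2 i)%N).
Proof. by rewrite -big_split; apply: eq_bigr => i _; rewrite exprD. Qed.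

Lemma box0 d : box d 0.
Proof.
by exists (fun=> 0); rewrite big1 // => g _; rewrite rmorph0 mul0r.
Qed.

Lemma boxD d x y : box d x -> box d y -> box d (x + y).
Proof.
move=> [c ->] [c' ->]; exists (fun g => c g + c' g).
by rewrite -big_split; apply: eq_bigr => g _; rewrite rmorphD mulrDl.
Qed.

Lemma boxZ d a x : box d x -> box d (iota a * x).
Proof.
move=> [c ->]; exists (fun g => a * c g).
by rewrite big_distrr; apply: eq_bigr => g _ /=; rewrite rmorphM mulrA.
Qed.

Lemma box_sum (T : Type) (r : seq T) (P : pred T) (F : T -> R) d :
  (forall i, P i -> box d (F i)) -> box d (\sum_(i <- r | P i) F i).
Proof.
move=> h; elim/big_ind: _ => //; [exact: box0 | exact: boxD].
Qed.

Lemma box_mono d (g : I -> nat) : (forall i, g i <= d)%N -> box d (mono g).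
Proof.
move=> gd; exists (fun c => (c == [ffun i => inord (g i)])%:R).
rewrite (bigD1 [ffun i => inord (g i)]) //= eqxx rmorph1 mul1r big1 ?addr0.
  by apply: eq_bigr => i _; rewrite ffunE inordK // ltnS.
by move=> c /negPf ->; rewrite rmorph0 mul0r.
Qed.

Lemma boxS d e x : (d <= e)%N -> box d x -> box e x.
Proof.
move=> de [c ->]; apply: box_sum => g _; apply/boxZ/box_mono => i.
by apply: leq_trans de; rewrite -ltnS.
Qed.

Lemma boxM d e x y : box d x -> box e y -> box (d + e) (x * y).
Proof.
move=> [c ->] [c' ->]; rewrite big_distrlr /=.
apply: box_sum => g _; apply: box_sum => h _.
rewrite mulrACA -rmorphM monoD; apply/boxZ/box_mono => i.
by rewrite leq_add // -ltnS.
Qed.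

Lemma alg_of0 : in_alg_of 0. Proof. by exists 0; exact: box0. Qed.

Lemma alg_ofD x y : in_alg_of x -> in_alg_of y -> in_alg_of (x + y).
Proof.
move=> [d hd] [e he]; exists (maxn d e); apply: boxD.
  exact: boxS (leq_maxl _ _) hd.
exact: boxS (leq_maxr _ _) he.
Qed.

Lemma alg_ofM x y : in_alg_of x -> in_alg_of y -> in_alg_of (x * y).
Proof. by move=> [d hd] [e he]; exists (d + e)%N; apply: boxM. Qed.

Lemma alg_of_mono g : in_alg_of (mono g).
Proof. by exists (\max_i g i)%N; apply: box_mono => i; apply: leq_bigmax. Qed.

Lemma mono0 : mono (fun=> 0%N) = 1. Proof. by rewrite /mono big1. Qed.

Lemma alg_of1 : in_alg_of 1. Proof. by rewrite -mono0; apply: alg_of_mono. Qed.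

Lemma alg_of_iota a : in_alg_of (iota a).
Proof.
rewrite -[iota a]mulr1; have [d hd] := alg_of1.
by exists d; apply: boxZ.
Qed.

Lemma mono1 i : mono (fun j => (j == i) : nat) = s i.
Proof.
rewrite /mono (bigD1 i) //= eqxx expr1 big1 ?mulr1 // => j /negPf ->.
by rewrite expr0.
Qed.

Lemma alg_of_gen i : in_alg_of (s i).
Proof. by rewrite -mono1; apply: alg_of_mono. Qed.

Lemma alg_of_sum (T : Type) (r : seq T) (P : pred T) (F : T -> R) :
  (forall i, P i -> in_alg_of (F i)) -> in_alg_of (\sum_(i <- r | P i) F i).
Proof.
move=> h; elim/big_ind: _ => //; [exact: alg_of0 | exact: alg_ofD].
Qed.

Lemma alg_of_exp x n : in_alg_of x -> in_alg_of (x ^+ n).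
Proof.
move=> h; elim: n => [|n IH]; first by rewrite expr0; exact: alg_of1.
by rewrite exprS; apply: alg_ofM.
Qed.

Lemma alg_ofN x : in_alg_of x -> in_alg_of (- x).
Proof.
move=> h; rewrite -mulN1r -(rmorph1 iota) -rmorphN.
by apply: alg_ofM h; apply: alg_of_iota.
Qed.

Lemma box_bound (T : finType) (F : T -> R) :
  (forall i, in_alg_of (F i)) -> exists d, forall i, box d (F i).
Proof.
move=> /choice [d hd]; exists (\max_i d i)%N => i.
exact: boxS (leq_bigmax _) (hd i).
Qed.

Lemma alg_of_min (P : R -> Prop) :
  (forall a, P (iota a)) -> (forall i, P (s i)) ->
  (forall x y, P x -> P y -> P (x + y)) ->
  (forall x y, P x -> P y -> P (x * y)) ->
  forall x, in_alg_of x -> P x.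
Proof.
move=> Pi Ps PD PM x [d [c ->]].
have P0 : P 0 by rewrite -(rmorph0 iota).
have P1 : P 1 by rewrite -(rmorph1 iota).
apply: (big_ind P) => [//|//|g _]; apply: (PM); first by [].
apply: (big_ind P) => [//|//|i _].
by elim: (nat_of_ord (g i)) => [|n IH]; rewrite ?expr0 // exprS; apply: PM.
Qed.

(** R is a localization of the algebra generated by s, stated inside R so that
   neither the algebra nor the multiplicative set is needed as an object. *)
Definition presented : Prop :=
  forall r : R, exists a t u, [/\ in_alg_of a, in_alg_of t, u * t = 1 & r * t = a].

Variable q : nat.
Hypotheses (q1 : (1 < q)%N) (Rq : qth_power_additive R q)
  (Kq : forall a : K, exists b, b ^+ q = a).
Let q0 : (0 < q)%N. Proof. exact: ltnW. Qed.

Lemma mono_digits g :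
  mono g = mono (fun i => (g i %/ q)%N) ^+ q * mono (fun i => (g i %% q)%N).
Proof.
rewrite /mono -prodrXl -big_split; apply: eq_bigr => i _ /=.
by rewrite -exprM -exprD -divn_eq.
Qed.

(** The monomials with all exponents below q generate R over its subring of
   q-th powers. *)
Definition digit_mono (g : {ffun I -> 'I_q}) : R := mono (fun i => g i).

Lemma digit_monoE g :
  mono g = mono (fun i => (g i %/ q)%N) ^+ q *
           digit_mono [ffun i => Ordinal (ltn_pmod (g i) q0)].
Proof.
rewrite mono_digits; congr (_ * _); apply: eq_bigr => i _.
by rewrite ffunE.
Qed.

Lemma alg_of_digits x : in_alg_of x ->
  exists r : {ffun I -> 'I_q} -> R,
    (forall g, in_alg_of (r g)) /\ x = \sum_g r g ^+ q * digit_mono g.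
Proof.
move=> [d [c ->]].
pose P y := exists r : {ffun I -> 'I_q} -> R,
    (forall g, in_alg_of (r g)) /\ y = \sum_g r g ^+ q * digit_mono g.
apply: (big_ind P) => [|y z [r [rA ->]] [r' [rA' ->]]|g _].
- exists (fun=> 0); split; first by move=> _; apply: alg_of0.
  by rewrite big1 // => g _; rewrite expr0n eqn0Ngt q0 mul0r.
- exists (fun g => r g + r' g); split; first by move=> g; apply: alg_ofD.
  by rewrite -big_split; apply: eq_bigr => g _ /=; rewrite Rq mulrDl.
have [b bE] := Kq (c g).
exists (fun h => if h == [ffun i => Ordinal (ltn_pmod (g i) q0)]
                 then iota b * mono (fun i => (g i %/ q)%N) else 0); split.
  move=> h; case: ifP => _; last exact: alg_of0.
  by apply: alg_ofM; [apply: alg_of_iota|apply: alg_of_mono].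
rewrite (bigD1 [ffun i => Ordinal (ltn_pmod (g i) q0)]) //= eqxx big1 ?addr0.
  by rewrite digit_monoE mulrA exprMn -bE rmorphXn.
by move=> h /negPf ->; rewrite expr0n eqn0Ngt q0 mul0r.
Qed.

(** A fraction a/t equals (a t^(q-1))/t^q, so denominators may be taken to be
   q-th powers and only numerators need to be expanded. *)
Lemma presented_digits : presented -> forall x : R,
  exists r : {ffun I -> 'I_q} -> R, x = \sum_g r g ^+ q * digit_mono g.
Proof.
move=> hp x; have [a [t [u [aA tA ut xt]]]] := hp x.
have [r [_ rE]] : exists r : {ffun I -> 'I_q} -> R,
    (forall g, in_alg_of (r g)) /\ a * t ^+ q.-1 = \sum_g r g ^+ q * digit_mono g.
  by apply: alg_of_digits; apply: alg_ofM => //; apply: alg_of_exp.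
exists (fun g => u * r g).
have -> : x = u ^+ q * (a * t ^+ q.-1).
  by rewrite -xt -mulrA -exprS prednK // mulrCA -exprMn ut expr1n mulr1.
by rewrite rE big_distrr; apply: eq_bigr => g _ /=; rewrite exprMn mulrA.
Qed.

End Family.

Lemma alg_of_sub (I J : finType) (s : I -> R) (s' : J -> R) :
  (forall i, in_alg_of s' (s i)) ->
  forall x, in_alg_of s x -> in_alg_of s' x.
Proof.
move=> h; apply: alg_of_min => //.
- exact: alg_of_iota.
- exact: alg_ofD.
- exact: alg_ofM.
Qed.

Section Contraction.
Variable q : nat.
Hypotheses (q1 : (1 < q)%N) (Rq : qth_power_additive R q)
  (Kq : forall a : K, exists b, b ^+ q = a).
Let q0 : (0 < q)%N. Proof. exact: ltnW. Qed.

(** A product of invertible denominators, one for each element, works for all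
   of them. *)
Lemma common_denominator (I : finType) (s : I -> R) (T : finType) (F : T -> R) :
  presented s -> exists t u, [/\ in_alg_of s t, u * t = 1 &
    forall i, in_alg_of s (t * F i)].
Proof.
move=> hp; have /choice [f hf] : forall i, exists tu : R * R,
    [/\ in_alg_of s tu.1, tu.2 * tu.1 = 1 & in_alg_of s (tu.1 * F i)].
  move=> i; have [a [t [u [aA tA ut xt]]]] := hp (F i).
  by exists (t, u); split=> //=; rewrite mulrC xt.
exists (\prod_i (f i).1), (\prod_i (f i).2); split.
- elim/big_ind: _ => [||i _]; [exact: alg_of1|exact: alg_ofM|].
  by have [] := hf i.
- by rewrite -big_split big1 // => i _; have [] := hf i.
move=> i; rewrite (bigD1 i) //= mulrAC.
have [_ _ h] := hf i; apply: alg_ofM h _.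
elim/big_ind: _ => [||j _]; [exact: alg_of1|exact: alg_ofM|].
by have [] := hf j.
Qed.

(** Adjoin to the generators the inverse u of a common denominator t of the
   values of the psi c on digit monomials.  The enlarged algebra is then
   stable under the psi c, which send a monomial with exponents at most D to
   something of box degree at most D/q + d, because psi (m^q x) = m psi x.
   Since D/q + d <= D as soon as D = 2d, the box of degree 2d is stable. *)
Lemma contraction (I C : finType) (s : I -> R) (psi : C -> R -> R) :
  presented s -> (forall c, inv_frob_linear q (psi c)) ->
  exists (H : finType) (w : H -> R) (h1 : H), w h1 = 1 /\
    forall c h, exists kap : H -> K, psi c (w h) = \sum_h' iota (kap h') * w h'.
Proof.
move=> hp psiP.
have [t [u [tA ut tF]]] := common_denominator
  (fun cg : C * {ffun I -> 'I_q} => psi cg.1 (digit_mono s cg.2)) hp.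
have tpsi c x : in_alg_of s x -> in_alg_of s (t * psi c x).
  move=> /(alg_of_digits q1 Rq Kq) [r [rA ->]].
  rewrite (inv_frob_sum (psiP c)) big_distrr; apply: alg_of_sum => g _ /=.
  rewrite (psiP c).2 mulrCA; apply: alg_ofM => //; exact: (tF (c, g)).
pose s' (i : option I) := if i is Some j then s j else u.
have ss' x : in_alg_of s x -> in_alg_of s' x.
  by apply: alg_of_sub => i; exact: (alg_of_gen s' (Some i)).
(* A monomial u^e m with e < q equals u^q t^(q - e) m, and t clears the
   denominators of psi (t^(q - e) m). *)
have psiA c (g : {ffun option I -> 'I_q}) : in_alg_of s' (psi c (digit_mono s' g)).
  have -> : digit_mono s' g = u ^+ q * (t ^+ (q - g None) * mono s (fun i => g (Some i))).
    rewrite /digit_mono /mono (bigD1 None) //= (reindex_omap Some id) => [|[]//] /=.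
    rewrite mulrA (eq_bigl xpredT) => [|i /=]; last by rewrite eqxx.
    congr (_ * _).
    have -> : u ^+ q = u ^+ g None * u ^+ (q - g None).
      by rewrite -exprD subnKC // ltnW.
    by rewrite -mulrA -exprMn ut expr1n mulr1.
  rewrite (psiP c).2.
  set y := _ * mono _ _.
  have -> : psi c y = u * (t * psi c y) by rewrite mulrA ut mul1r.
  have uA : in_alg_of s' u by exact: (alg_of_gen s' None).
  apply: alg_ofM => //; apply: alg_ofM => //; apply/ss'/tpsi.
  by apply: alg_ofM; [exact: alg_of_exp|exact: alg_of_mono].
have [d hd] := box_bound (fun cg : C * _ => psiA cg.1 cg.2).
(* Box degree D = 2d, for which D/q + d <= D. *)
exists {ffun option I -> 'I_(d + d).+1}.
exists (fun g : {ffun option I -> 'I_(d + d).+1} => mono s' (fun i => g i)).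
exists [ffun=> ord0]; split.
  by rewrite -[RHS](mono0 s'); apply: eq_bigr => i _; rewrite ffunE.
move=> c g; suff [kap ->] : box s' (d + d) (psi c (mono s' (fun i => g i))).
  by exists kap.
rewrite (digit_monoE s' q1) (psiP c).2.
apply: (@boxS _ _ ((d + d) %/ q + d)).
  rewrite leq_add2r; apply: leq_trans (@leq_div2l (d + d) 2 q isT q1) _.
  by rewrite addnn -muln2 mulnK.
apply: boxM; last exact: (hd (c, _)).
by apply: box_mono => i; apply: leq_div2r; rewrite -ltnS.
Qed.

End Contraction.
End Box.

(** * Noetherian rings *)

Section Ideals.
Variable R : comNzRingType.
Implicit Types (J : R -> Prop) (g : seq R).

Definition is_ideal J : Prop :=
  [/\ J 0, forall x y, J x -> J y -> J (x + y) & forall a x, J x -> J (a * x)].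

(** Membership in the ideal generated by a sequence, by recursion on the
   sequence; this form suits the addition and removal of one generator. *)
Fixpoint gen g (x : R) : Prop :=
  if g is y :: g' then exists r, gen g' (x - r * y) else x = 0.

Definition noetherian : Prop :=
  forall J, is_ideal J ->
    exists g, (forall y, y \in g -> J y) /\ forall x, J x -> gen g x.

Lemma idealN J x : is_ideal J -> J x -> J (- x).
Proof. by move=> [_ _ JM] Jx; rewrite -mulN1r; apply: JM. Qed.

Lemma idealB J x y : is_ideal J -> J x -> J y -> J (x - y).
Proof. by move=> hJ Jx Jy; have [_ JD _] := hJ; apply: JD => //; apply: idealN. Qed.

Lemma gen_ideal g : is_ideal (gen g).
Proof.
elim: g => [|y g [g0 gD gM]] /=.
  by split=> // [x z -> ->|a x ->]; rewrite ?addr0 ?mulr0.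
split; first by exists 0; rewrite mul0r subr0.
  move=> x z [r hr] [r' hr']; exists (r + r').
  by rewrite mulrDl opprD addrACA; apply: gD.
by move=> a x [r hr]; exists (a * r); rewrite -mulrA -mulrBr; apply: gM.
Qed.

Lemma gen_tail y g x : gen g x -> gen (y :: g) x.
Proof. by exists 0; rewrite mul0r subr0. Qed.

Lemma gen_mem g y : y \in g -> gen g y.
Proof.
elim: g => // z g IH; rewrite inE => /predU1P[->|/IH/gen_tail//].
by exists 1; rewrite mul1r subrr; have [] := gen_ideal g.
Qed.

Lemma gen_min g J x : is_ideal J -> (forall y, y \in g -> J y) -> gen g x -> J x.
Proof.
move=> hJ; have [J0 JD JM] := hJ.
elim: g x => [x _ -> //|y g IH] x gJ /= [r hr].
rewrite -(subrK (r * y) x); apply: (JD).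
  by apply: IH hr => z zg; apply: gJ; rewrite inE zg orbT.
by apply: (JM); apply: gJ; rewrite inE eqxx.
Qed.

Lemma gen_sub g g' x : (forall y, y \in g -> gen g' y) -> gen g x -> gen g' x.
Proof. by move=> h; apply: gen_min => //; apply: gen_ideal. Qed.

Definition initial_seg (a : nat -> R) n : seq R := [seq a i | i <- iota 0 n].

Lemma initial_seg_sub a n m x : (n <= m)%N ->
  gen (initial_seg a n) x -> gen (initial_seg a m) x.
Proof.
move=> nm; apply: gen_sub => y /mapP[i]; rewrite mem_iota /= add0n => ilt ->.
by apply/gen_mem/map_f; rewrite mem_iota add0n (leq_trans ilt).
Qed.

(** The ascending chain condition in the form needed by the basis theorem: in
   any sequence some term depends linearly on the previous ones. *)
Lemma noetherian_seq (a : nat -> R) : noetherian ->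
  exists n, gen (initial_seg a n) (a n).
Proof.
pose J x := exists n, gen (initial_seg a n) x.
have JJ : is_ideal J.
  split; first by exists 0%N.
    move=> x y [n hn] [m hm]; exists (maxn n m).
    have [_ gD _] := gen_ideal (initial_seg a (maxn n m)); apply: gD.
      exact: initial_seg_sub (leq_maxl _ _) hn.
    exact: initial_seg_sub (leq_maxr _ _) hm.
  by move=> b x [n hn]; exists n; have [_ _ gM] := gen_ideal (initial_seg a n); apply: gM.
move=> /(_ J JJ) [g [gJ Jg]].
have [n hn] : exists n, forall y, y \in g -> gen (initial_seg a n) y.
  elim: g gJ {Jg} => [|z g IH] gJ; first by exists 0%N.
  have [y yg|n hn] := IH; first by apply: gJ; rewrite inE yg orbT.
  have [m hm] := gJ z (mem_head _ _); exists (maxn n m) => y.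
  rewrite inE => /predU1P[->|/hn h]; first exact: initial_seg_sub (leq_maxr _ _) hm.
  exact: initial_seg_sub (leq_maxl _ _) h.
exists n; apply: (gen_sub hn); apply: Jg; exists n.+1; apply/gen_mem/map_f.
by rewrite mem_iota add0n ltnSn.
Qed.

End Ideals.

Lemma gen_map (P R : comNzRingType) (u : {rmorphism P -> R}) g x :
  gen g x -> gen (map u g) (u x).
Proof.
elim: g x => [x ->|y g IH x [r hr]] /=; first exact: rmorph0.
by exists (u r); rewrite -rmorphM -rmorphB; apply: IH.
Qed.

Section Hilbert.
Variable R : comNzRingType.

(** A combination of leading coefficients is the coefficient of a combination
   of the polynomials, after shifting all of them to a common degree. *)
Lemma gen_lead_coef (L : seq {poly R}) d c :
  (forall y, y \in L -> (size y <= d.+1)%N) -> gen (map lead_coef L) c ->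
  exists h, [/\ gen L h, (size h <= d.+1)%N & h`_d = c].
Proof.
elim: L c => [c _ ->|y L IH c Ld [r hr]].
  by exists 0; rewrite size_poly0 coef0.
have [z zL|h [Lh hd hc]] := IH (c - r * lead_coef y) _ hr.
  by apply: Ld; rewrite inE zL orbT.
have yd : (size y <= d.+1)%N by apply: Ld; rewrite inE eqxx.
have [y0|y0] := eqVneq y 0.
  exists h; split=> //; first exact: gen_tail.
  by rewrite hc y0 lead_coef0 mulr0 subr0.
rewrite -size_poly_gt0 in y0.
exists (h + r%:P * 'X^(d.+1 - size y) * y); split.
- by exists (r%:P * 'X^(d.+1 - size y)); rewrite addrK.
- apply: leq_trans (size_polyD _ _) _; rewrite geq_max hd /=.
  rewrite -mulrA mul_polyC; apply: leq_trans (size_scale_leq _ _) _.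
  apply/leq_sizeP => j dj; rewrite coefXnM; case: ltnP => // _.
  rewrite nth_default //; move: yd dj; set sy := size y; clearbody sy; lia.
rewrite coefD hc -mulrA coefCM coefXnM lead_coefE.
have [-> ->] : ((d < d.+1 - size y)%N = false) /\ (d - (d.+1 - size y) = (size y).-1)%N.
  by move: yd y0; set sy := size y; clearbody sy; lia.
by rewrite subrK.
Qed.

(** Hilbert's basis theorem.  If an ideal is not finitely generated, choose
   successively elements of least size outside the ideal generated by the
   previous ones.  A linear relation between their leading coefficients lowers
   the size of the last one, against minimality. *)
Lemma noetherian_poly : noetherian R -> noetherian {poly R}.
Proof.
move=> hR J hJ; apply: contrapT => hn.
have [J0 JD JM] := hJ.
pose inJ (g : seq {poly R}) := forall y, y \in g -> J y.
have step g : exists f, inJ g ->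
    [/\ J f, ~ gen g f & forall f', J f' -> ~ gen g f' -> (size f <= size f')%N].
  have [gJ|] := pselect (inJ g); last by exists 0.
  have ex : exists n, `[< exists f, [/\ J f, ~ gen g f & size f = n] >].
    apply: contrapT => h; apply: hn; exists g; split=> // x Jx.
    apply: contrapT => gx; apply: h; exists (size x); apply/asboolP.
    by exists x.
  case: (ex_minnP ex) => n /asboolP[f [Jf gf <-]] hmin; exists f => _.
  split=> // f' Jf' gf'; apply: hmin; apply/asboolP; by exists f'.
have [pk pkP] := choice step.
pose L := fix L n := if n is m.+1 then rcons (L m) (pk (L m)) else [::].
pose f n := pk (L n).
have LE n : L n = initial_seg f n.
  elim: n => //= n IH.
  by rewrite /initial_seg -[in RHS]addn1 iotaD map_cat /= cats1 add0n -/(initial_seg f n) -IH.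
have LJ n : inJ (L n).
  elim: n => [|n IH] y //=; rewrite mem_rcons inE => /predU1P[->|/IH//].
  by have [] := pkP _ IH.
have fP n : [/\ J (f n), ~ gen (initial_seg f n) (f n) &
    forall f', J f' -> ~ gen (initial_seg f n) f' -> (size (f n) <= size f')%N].
  by rewrite -LE; exact: (pkP _ (LJ n)).
clear LE LJ; clearbody f.
have fS n m : (n <= m)%N -> (size (f n) <= size (f m))%N.
  move=> nm; have [_ _ fmin] := fP n; have [Jm gm _] := fP m.
  apply: fmin => // h; apply: gm; exact: initial_seg_sub h.
have [n hl] := noetherian_seq (lead_coef \o f) hR.
have [Jn gn nmin] := fP n.
have fn0 : (0 < size (f n))%N.
  rewrite size_poly_gt0; apply/eqP => f0; apply: gn; rewrite f0.
  by have [] := gen_ideal (initial_seg f n).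
have [||h [Lh hs hc]] :=
    @gen_lead_coef (initial_seg f n) (size (f n)).-1 (lead_coef (f n)).
- by move=> y /mapP[i]; rewrite mem_iota add0n => /andP[_ /ltnW /fS le] ->; rewrite prednK.
- by rewrite -map_comp.
rewrite prednK // in hs.
have Jh : J h.
  apply: gen_min Lh => // y /mapP[i _ ->]; by have [] := fP i.
have : (size (f n) <= size (f n - h)%R)%N.
  apply: nmin; first exact: idealB.
  move=> g'; apply: gn; rewrite -(subrK h (f n)).
  by have [_ gD _] := gen_ideal (initial_seg f n); apply: gD.
rewrite leqNgt -(prednK fn0) ltnS => /negP; apply.
apply/leq_sizeP => j; rewrite leq_eqVlt => /predU1P[<-|ltj].
  by rewrite coefB hc lead_coefE subrr.
rewrite prednK // in ltj.
by rewrite coefB !nth_default ?subrr // (leq_trans hs).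
Qed.

End Hilbert.

Lemma noetherian_field (K : fieldType) : noetherian K.
Proof.
move=> J [J0 _ JM].
have [[x [Jx x0]]|h] := pselect (exists x, J x /\ x != 0).
  exists [:: x]; split=> [y|y _]; first by rewrite inE => /eqP ->.
  by exists (y / x); rewrite divfK ?subrr.
exists [::]; split=> // x Jx; apply: contrapT => /eqP x0; apply: h.
by exists x.
Qed.

(** Covers both quotients and localizations: it suffices that every element of
   R becomes an image of an element of P after multiplication by an invertible
   element. *)
Lemma noetherian_cover (P R : comNzRingType) (u : {rmorphism P -> R}) :
  noetherian P ->
  (forall x, exists p s v, u p = x * u s /\ v * u s = 1) -> noetherian R.
Proof.
move=> hP hu J [J0 JD JM].
have [|g [gJ Jg]] := hP (fun p => J (u p)).
  split; first by rewrite rmorph0.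
  - by move=> x y; rewrite rmorphD; apply: JD.
  - by move=> a x; rewrite rmorphM; apply: JM.
exists (map u g); split; first by move=> _ /mapP[y yg ->]; apply: gJ.
move=> x Jx; have [p [s [v [up vs]]]] := hu x.
have -> : x = v * u p by rewrite up mulrCA vs mulr1.
have [_ _ gM] := gen_ideal (map u g); apply: gM; apply/gen_map/Jg.
by rewrite up mulrC; apply: JM.
Qed.

(** Iterated polynomial rings, built one generator at a time, avoid
   multivariate polynomials. *)
Lemma noetherian_above (K : fieldType) (R : comNzRingType)
    (iota : {rmorphism K -> R}) (l : seq R) :
  exists (P : comNzRingType) (u : {rmorphism P -> R}), [/\ noetherian P,
    forall a, exists p, u p = iota a & forall y, y \in l -> exists p, u p = y].
Proof.
elim: l => [|y l [P [u [nP uK ul]]]].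
  by exists K, iota; split=> //; [exact: noetherian_field|move=> a; exists a].
have cu : commr_rmorph u y by move=> p; exact: mulrC.
exists {poly P}, (horner_morph cu); split; first exact: noetherian_poly.
  by move=> a; have [p <-] := uK a; exists p%:P; rewrite /= horner_morphC.
move=> z; rewrite inE => /predU1P[->|/ul [p <-]].
  by exists 'X; rewrite /= horner_morphX.
by exists p%:P; rewrite /= horner_morphC.
Qed.

Lemma presented_noetherian (K : fieldType) (R : comNzRingType)
    (iota : {rmorphism K -> R}) (I : finType) (s : I -> R) :
  presented iota s -> noetherian R.
Proof.
move=> hp; have [P [u [nP uK us]]] := noetherian_above iota (codom s).
have uA x : in_alg_of iota s x -> exists p, u p = x.
  apply: (@alg_of_min _ _ iota _ s (fun x => exists p, u p = x)) => //.
  - by move=> i; apply: us; apply: codom_f.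
  - by move=> _ _ [p <-] [p' <-]; exists (p + p'); rewrite rmorphD.
  - by move=> _ _ [p <-] [p' <-]; exists (p * p'); rewrite rmorphM.
apply: (noetherian_cover (u := u) nP) => x.
have [a [t [v [/uA[p <-] /uA[p' <-] h1 h2]]]] := hp x.
by exists p, p', v; rewrite h2.
Qed.

(** * Adjoining roots of order q *)

Definition mk_rmorphism (A B : nzRingType) (f : A -> B)
    (fB : {morph f : x y / x - y}) (fM : {morph f : x y / x * y}) (f1 : f 1 = 1) :
    {rmorphism A -> B} :=
  HB.pack f (GRing.isZmodMorphism.Build A B f fB)
    (GRing.isMonoidMorphism.Build A B f (f1, fM)).

Definition mk_lrmorphism (K : nzRingType) (A B : algType K) (f : A -> B)
    (fB : {morph f : x y / x - y}) (fM : {morph f : x y / x * y}) (f1 : f 1 = 1)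
    (fZ : forall a, {morph f : x / a *: x}) : {lrmorphism A -> B} :=
  HB.pack f (GRing.isZmodMorphism.Build A B f fB)
    (GRing.isMonoidMorphism.Build A B f (f1, fM))
    (GRing.isScalable.Build K A B *:%R f fZ).

Section Via.
Variables (K : comNzRingType) (A : comNzRingType) (iota : {rmorphism K -> A}).
(** The ring A, made a K-algebra along iota.  The morphism is a phantom
   argument of the type so that several algebra structures on one ring can
   coexist. *)
Definition alg_via : Type := let _ := iota in A.
HB.instance Definition _ := GRing.ComNzRing.on alg_via.
Let sc (a : K) (x : alg_via) : alg_via := iota a * x.
Fact via_A a b v : sc a (sc b v) = sc (a * b) v.
Proof. by rewrite /sc rmorphM mulrA. Qed.
Fact via_1 : left_id 1 sc. Proof. by move=> x; rewrite /sc rmorph1 mul1r. Qed.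
Fact via_Dr : right_distributive sc +%R.
Proof. by move=> a x y; rewrite /sc mulrDr. Qed.
Fact via_Dl v : {morph sc^~ v: a b / a + b}.
Proof. by move=> a b; rewrite /sc rmorphD mulrDl. Qed.
HB.instance Definition _ :=
  GRing.Zmodule_isLmodule.Build K alg_via via_A via_1 via_Dr via_Dl.
Fact via_Al (a : K) (u v : alg_via) : a *: (u * v) = (a *: u) * v.
Proof. exact: mulrA. Qed.
HB.instance Definition _ := GRing.Lmodule_isLalgebra.Build K alg_via via_Al.
HB.instance Definition _ := GRing.Lalgebra_isComAlgebra.Build K alg_via.
Lemma alg_viaZ (a : K) (x : alg_via) : a *: x = iota a * x. Proof. by []. Qed.
End Via.

Section Frobenius.
Variables (p f : nat).
Local Notation q := (p ^ f)%N.

Lemma pchar_qadd (R : comNzRingType) : p \in [pchar R] -> qth_power_additive R q.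
Proof.
move=> cR x y; apply: exprDn_pchar; rewrite pnatX.
by rewrite (eq_pnat _ (pcharf_eq cR)) pnat_id ?(pcharf_prime cR).
Qed.

End Frobenius.

Lemma qth_powerB (R : nzRingType) q (x y : R) :
  qth_power_additive R q -> (x - y) ^+ q = x ^+ q - y ^+ q.
Proof. by move=> Rq; rewrite -[x in RHS](subrK y) [in RHS]Rq addrK. Qed.

Lemma perfect_qth_root (K : fieldType) p f :
  (forall x : K, exists y, y ^+ p = x) -> forall x : K, exists y, y ^+ (p ^ f) = x.
Proof.
move=> kp; elim: f => [|n IH] x; first by exists x; rewrite expr1.
by have [y yE] := IH x; have [z zE] := kp y; exists z; rewrite expnS exprM zE.
Qed.

Section Root.
Variables (K : fieldType) (q : nat).
Hypotheses (q0 : (0 < q)%N) (hq : qth_power_additive K q)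
  (Kq : forall x : K, exists y, y ^+ q = x).

(** On a perfect field the inverse of the Frobenius is a ring morphism. *)
Lemma qth_root_exists : exists rho : {rmorphism K -> K}, forall x, rho x ^+ q = x.
Proof.
have [g gE] := choice Kq.
have inj (x y : K) : x ^+ q = y ^+ q -> x = y.
  move=> e; apply/eqP; rewrite -subr_eq0; apply/eqP.
  have : (x - y) ^+ q = 0 by rewrite qth_powerB // e subrr.
  by move/eqP; rewrite expf_eq0 q0 => /eqP.
have gB : {morph g : x y / x - y} by move=> x y; apply: inj; rewrite qth_powerB // !gE.
have gM : {morph g : x y / x * y} by move=> x y; apply: inj; rewrite exprMn !gE.
have g1 : g 1 = 1 by apply: inj; rewrite gE expr1n.
by exists (mk_rmorphism gB gM g1).
Qed.
End Root.

(** The data of the polynomial ring E = R[X_i] above R (rc_in), the map E -> R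
   with r |-> r^q and X_i |-> s_i (rc_pi), the relations X_i^q - s_i (rc_rel),
   and the R-linear coordinates of E modulo these relations in the basis of
   monomials with exponents below q (rc_coord; rc_base lists the images of
   these monomials in R).  Working in E modulo the relations, instead of in
   the quotient, avoids a tower of quotient rings.  By rc_frob the kernel of
   rc_pi is nil modulo the relations, and by rc_piE the coordinates determine
   rc_pi. *)
Record root_cover (p q : nat) (R : comNzRingType) := RootCover {
  rc_ring :> comNzRingType;
  rc_char : p \in [pchar rc_ring];
  rc_noeth : noetherian rc_ring;
  rc_in : {rmorphism R -> rc_ring};
  rc_pi : {rmorphism rc_ring -> R};
  rc_piin : forall r, rc_pi (rc_in r) = r ^+ q;
  rc_rel : seq rc_ring;
  rc_pirel : forall g, g \in rc_rel -> rc_pi g = 0;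
  rc_frob : forall e, gen rc_rel (e ^+ q - rc_in (rc_pi e));
  rc_idx : finType;
  rc_base : rc_idx -> R;
  rc_coord : rc_idx -> rc_ring -> R;
  rc_coordD : forall t x y, rc_coord t (x + y) = rc_coord t x + rc_coord t y;
  rc_coordZ : forall t r x, rc_coord t (rc_in r * x) = r * rc_coord t x;
  rc_coordI : forall t x, gen rc_rel x -> rc_coord t x = 0;
  rc_piE : forall x, rc_pi x = \sum_t rc_coord t x ^+ q * rc_base t }.

Section Cover.
Variables (p f : nat) (R : comNzRingType).
Hypotheses (cR : p \in [pchar R]) (nR : noetherian R).
Local Notation q := (p ^ f)%N.
Let Rq : qth_power_additive R q := pchar_qadd f cR.
Let p1 : (1 < p)%N. Proof. exact/prime_gt1/(pcharf_prime cR). Qed.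
Let q0 : (0 < q)%N. Proof. by rewrite expn_gt0 (ltnW p1). Qed.
Local Notation cover := (root_cover p q R).

Lemma root_cover_base : cover.
Proof.
have FB : {morph (fun x : R => x ^+ q) : x y / x - y}.
  by move=> x y; apply: qth_powerB.
have FM : {morph (fun x : R => x ^+ q) : x y / x * y} by move=> x y; apply: exprMn.
pose F := mk_rmorphism FB FM (expr1n R q).
by apply: (@RootCover p q R R cR nR (idfun : {rmorphism R -> R}) F _ [::] _ _
  unit (fun=> 1) (fun=> id)) => //= e; rewrite ?subrr ?big_const ?card_unit //=
  addr0 mulr1.
Defined.

Section Adjoin.
Variables (E : cover) (y : R).
Local Notation i := (rc_in E).
Local Notation ppi := (rc_pi E).
Let cpi : commr_rmorph ppi y. Proof. by move=> e; apply: mulrC. Qed.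
Let pi' : {rmorphism {poly E} -> R} := horner_morph cpi.
Let i' : {rmorphism R -> {poly E}} := polyC \o i.
Let rel' : seq {poly E} := ('X^q - (i y)%:P) :: map polyC (rc_rel E).
Let coord' (tm : rc_idx E * 'I_q) (e : {poly E}) : R :=
  \sum_(a < size e | (a %% q == tm.2)%N) y ^+ (a %/ q) * rc_coord tm.1 e`_a.

Lemma rc_coord0 t : rc_coord t (0 : E) = 0.
Proof. by apply: (@addrI _ (rc_coord t (0 : E))); rewrite -rc_coordD !addr0. Qed.

Let coordE n tm (e : {poly E}) : (size e <= n)%N ->
  coord' tm e = \sum_(a < n | (a %% q == tm.2)%N) y ^+ (a %/ q) * rc_coord tm.1 e`_a.
Proof.
move=> le; rewrite /coord' (big_ord_widen_cond n (fun a => (a %% q == tm.2)%N)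
  (fun a => y ^+ (a %/ q) * rc_coord tm.1 e`_a) le) [RHS](bigID (fun a : 'I_n => (a < size e)%N)) /=.
rewrite [X in _ = _ + X]big1 ?addr0 // => a /andP[_]; rewrite -leqNgt => ?.
by rewrite nth_default // rc_coord0 mulr0.
Qed.

Let char' : p \in [pchar {poly E}].
Proof. by rewrite pchar_poly; apply: rc_char. Qed.

Let noeth' : noetherian {poly E}.
Proof. exact/noetherian_poly/rc_noeth. Qed.

Let piin' r : pi' (i' r) = r ^+ q.
Proof. by rewrite /= horner_morphC rc_piin. Qed.

Let pirel' g : g \in rel' -> pi' g = 0.
Proof.
rewrite inE => /predU1P[->|/mapP[h /rc_pirel h0 ->]]; last by rewrite /= horner_morphC.
rewrite rmorphB rmorphXn /= horner_morphX horner_morphC rc_piin subrr //.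
Qed.

Let relC x : gen (rc_rel E) x -> gen rel' x%:P.
Proof. by move=> /(gen_map polyC) h; apply: gen_tail. Qed.

Let frob' e : gen rel' (e ^+ q - i' (pi' e)).
Proof.
have [g0 gD gM] := gen_ideal rel'.
elim/poly_ind: e => [|e c IH].
  by rewrite !rmorph0 expr0n eqn0Ngt q0 subr0.
rewrite !rmorphD (pchar_qadd f char') !rmorphM exprMn /= horner_morphX horner_morphC.
set u := e ^+ q; set v := (i (pi' e))%:P.
have -> : u * 'X^q + c%:P ^+ q - (v * (i y)%:P + (i (ppi c))%:P) =
   'X^q * (u - v) + v * ('X^q - (i y)%:P) + (c ^+ q - i (ppi c))%:P.
  rewrite rmorphB rmorphXn /= !mulrBr (mulrC 'X^q) (mulrC 'X^q).
  by rewrite !addrA subrK opprD !addrA; congr (_ - _); rewrite addrAC.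
apply: (gD); first apply: (gD).
- exact: gM.
- by apply: (gM); apply: gen_mem; rewrite inE eqxx.
- by apply: relC; apply: rc_frob.
Qed.

Let coordD' t x z : coord' t (x + z) = coord' t x + coord' t z.
Proof.
pose n := maxn (size x) (size z).
rewrite !(@coordE n) ?leq_maxl ?leq_maxr //; last exact: size_polyD.
by rewrite -big_split; apply: eq_bigr => a _ /=; rewrite coefD rc_coordD mulrDr.
Qed.

Let coordZ' t r x : coord' t (i' r * x) = r * coord' t x.
Proof.
rewrite (@coordE (size x)); last first.
  by rewrite /= mul_polyC size_scale_leq.
rewrite /coord' big_distrr; apply: eq_bigr => a _ /=.
by rewrite coefCM rc_coordZ mulrCA.
Qed.

Let coord0' t : coord' t 0 = 0.
Proof. by rewrite /coord' big1 // => a _; rewrite coef0 rc_coord0 mulr0. Qed.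

Let coordI' t x : gen rel' x -> coord' t x = 0.
Proof.
have gen_coef (g : seq E) (z : {poly E}) : gen (map polyC g) z -> forall a, gen g z`_a.
  elim: g z => [z -> a|h g IH z [r hr] a] /=; first by rewrite coef0.
  by exists r`_a; have := IH _ hr a; rewrite coefB coefMC.
move=> [r hr].
have -> : x = (x - r * ('X^q - (i y)%:P)) + r * 'X^q - i' y * r.
  by rewrite mulrBr opprB [i' y * r]mulrC /= addrA subrK addrK.
have coordN z : coord' t (- z) = - coord' t z.
  by apply: (@addrI _ (coord' t z)); rewrite -coordD' !subrr coord0'.
rewrite coordD' (coordD' t (x - r * ('X^q - (i y)%:P))) coordN coordZ'.
have -> : coord' t (x - r * ('X^q - (i y)%:P)) = 0.
  by rewrite /coord' big1 // => a _; rewrite rc_coordI ?mulr0 //; apply: gen_coef.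
rewrite add0r; apply/eqP; rewrite subr_eq0; apply/eqP.
rewrite (@coordE (q + size r)); last first.
  apply: leq_trans (size_polyMleq _ _) _; rewrite size_polyXn.
  by rewrite addnS /= addnC.
rewrite big_mkcond big_split_ord /= [X in X + _]big1 ?add0r; last first.
  by move=> a _; rewrite coefMXn ltn_ord rc_coord0 mulr0 if_same.
rewrite -big_mkcond /coord' big_distrr; apply: eq_big => a /=.
  by rewrite modnDl.
by move=> _; rewrite coefMXn ltnNge leq_addr /= addKn divnDl // divnn q0 exprS mulrA.
Qed.

Let piE' x : pi' x = \sum_t coord' t x ^+ q * (rc_base t.1 * y ^+ t.2).
Proof.
rewrite -(pair_bigA _ (fun t (m : 'I_q) => coord' (t, m) x ^+ q * (rc_base t * y ^+ m))) /=.
rewrite exchange_big /=.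
transitivity (\sum_(a < size x) ppi x`_a * y ^+ a).
  rewrite -{1}[x]coefK poly_def rmorph_sum; apply: eq_bigr => a _.
  by rewrite -mul_polyC rmorphM rmorphXn /= horner_morphC horner_morphX.
have -> : \sum_(a < size x) ppi x`_a * y ^+ a =
  \sum_(m < q) \sum_(a < size x | (a %% q == m)%N) ppi x`_a * y ^+ a.
  rewrite (partition_big (fun a : 'I_(size x) => Ordinal (ltn_pmod a q0)) xpredT) //=.
apply: eq_bigr => m _.
have Rq0 : (0 : R) ^+ q = 0 by rewrite expr0n eqn0Ngt q0.
under [RHS]eq_bigr => t _ do rewrite /coord' (qth_power_sum q0 Rq) big_distrl /=.
rewrite [RHS]exchange_big /=; apply: eq_bigr => a /eqP <-.
rewrite rc_piE big_distrl /=; apply: eq_bigr => t _.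
rewrite exprMn -exprM {2}(divn_eq a q) exprD -!mulrA.
by rewrite [RHS]mulrCA; congr (_ * _); rewrite mulrCA.
Qed.

Definition root_cover_adjoin : cover :=
  RootCover char' noeth' piin' pirel' frob' coordD' coordZ' coordI' piE'.

Lemma root_cover_adjoin_new : exists e, rc_pi root_cover_adjoin e = y.
Proof. by exists 'X; rewrite /= horner_morphX. Qed.

Lemma root_cover_adjoin_old e : exists e', rc_pi root_cover_adjoin e' = rc_pi E e.
Proof. by exists e%:P; rewrite /= horner_morphC. Qed.

End Adjoin.

(** The variables are adjoined one at a time ([root_cover_adjoin]); the new
   coordinates are those of the coefficients, collected by the residue modulo
   q of the exponent of the new variable. *)
Lemma root_cover_exists (l : seq R) :
  exists E : cover, forall y, y \in l -> exists e, rc_pi E e = y.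
Proof.
elim: l => [|y l [E hE]]; first by exists root_cover_base.
exists (root_cover_adjoin E y) => z; rewrite inE => /predU1P[->|/hE [e <-]].
  exact: root_cover_adjoin_new.
exact: root_cover_adjoin_old.
Qed.
End Cover.

(** * Quotients, lifting along nilpotents, and Frobenius dual bases *)

Section Quotient.
Variables (E : comNzRingType) (I : E -> Prop).
Hypotheses (hI : is_ideal I) (I1 : ~ I 1).

Let ipred : {pred E} := fun x => `[< I x >].

Fact ipred_idealr : idealr_closed ipred.
Proof.
have [I0 ID IM] := hI; split; rewrite ?unfold_in.
- exact/asboolP.
- exact/asboolP.
- move=> a u v; rewrite !unfold_in => /asboolP Iu /asboolP Iv.
  by apply/asboolP; apply: ID => //; apply: IM.
Qed.

HB.instance Definition _ := isIdealr.Build E ipred ipred_idealr.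

(** Hides the construction of the quotient ring; only its universal features
   are used. *)
Lemma quotient_exists : exists (Q : comNzRingType) (u : {rmorphism E -> Q}),
  (forall y, exists x, u x = y) /\ (forall x, u x = 0 <-> I x).
Proof.
exists {ideal_quot ipred}.
exists (\pi_{ideal_quot ipred} : {rmorphism E -> {ideal_quot ipred}})%qT.
split; first by move=> y; exists (repr y); exact: reprK.
pose u := (\pi_{ideal_quot ipred} : {rmorphism E -> {ideal_quot ipred}})%qT.
move=> x; have := Quotient.idealrBE ipred x 0; rewrite subr0 unfold_in /= => e.
rewrite -/u; split=> [ux|Ix].
  apply/asboolP; rewrite e; apply/eqP.
  exact: (etrans ux (esym (rmorph0 u))).
have /eqP h : (x == 0 %[mod {ideal_quot ipred}])%qT by rewrite -e; apply/asboolP.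
exact: (etrans h (rmorph0 u)).
Qed.
End Quotient.

Lemma factor_exists (E Q Q' : comNzRingType) (u : {rmorphism E -> Q})
    (u' : {rmorphism E -> Q'}) :
  (forall y, exists x, u' x = y) -> (forall x, u' x = 0 -> u x = 0) ->
  exists v : {rmorphism Q' -> Q}, forall x, v (u' x) = u x.
Proof.
move=> /choice [r rE] uu'.
have vE x : u (r (u' x)) = u x.
  apply/eqP; rewrite -subr_eq0 -rmorphB; apply/eqP/uu'.
  by rewrite rmorphB rE subrr.
have vB : {morph u \o r : x y / x - y}.
  by move=> x y /=; rewrite -rmorphB -[x in LHS]rE -[y in LHS]rE -rmorphB vE.
have vM : {morph u \o r : x y / x * y}.
  by move=> x y /=; rewrite -rmorphM -[x in LHS]rE -[y in LHS]rE -rmorphM vE.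
have v1 : (u \o r) 1 = 1 by rewrite /= -[1 in LHS](rmorph1 u') vE rmorph1.
by exists (mk_rmorphism vB vM v1).
Qed.

Section Lifting.
Variables (k : fieldType) (R : comAlgType k) (E : comNzRingType).
Variables (iota : {rmorphism k -> E}) (ppi : {rmorphism E -> R}).

(** A section of ppi that is a morphism of k-algebras up to I; this represents
   a morphism to E/I without mentioning the quotient. *)
Definition lift_mod (I : E -> Prop) (h : R -> E) : Prop :=
  [/\ forall x y, I (h (x + y) - (h x + h y)),
      forall x y, I (h (x * y) - h x * h y),
      forall a x, I (h (a *: x) - iota a * h x),
      I (h 1 - 1)
    & forall x, ppi (h x) = x].

Lemma lift_mod_sub (I I' : E -> Prop) h :
  (forall x, I x -> I' x) -> lift_mod I h -> lift_mod I' h.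
Proof. by move=> s [h1 h2 h3 h4 h5]; split=> //; auto. Qed.

Hypothesis smooth : formally_smooth R.

(** The infinitesimal lifting property, applied to E/I' -> E/I, whose kernel
   has square zero. *)
Lemma lift_mod_step (I I' : E -> Prop) :
  is_ideal I -> is_ideal I' -> (forall x, I' x -> I x) ->
  (forall x, I x -> ppi x = 0) -> (forall x y, I x -> I y -> I' (x * y)) ->
  (exists h, lift_mod I h) -> exists h, lift_mod I' h.
Proof.
move=> hI hI' I'I Ipi II [h [hD hM hZ h1 hpi]].
have I1 : ~ I 1 by move=> /Ipi; rewrite rmorph1; apply/eqP; rewrite oner_eq0.
have I'1 : ~ I' 1 by move=> /I'I.
have [D [u [us uker]]] := quotient_exists hI I1.
have [C [u' [us' uker']]] := quotient_exists hI' I'1.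
have [v vE] : exists v : {rmorphism C -> D}, forall x, v (u' x) = u x.
  by apply: factor_exists => // x /uker' /I'I /uker.
have ue x y : I (x - y) -> u x = u y.
  by move=> /uker/eqP; rewrite rmorphB subr_eq0 => /eqP.
have u'e x y : u' x = u' y -> I' (x - y).
  by move=> e; apply/uker'; rewrite rmorphB e subrr.
pose A : comAlgType k := alg_via (u' \o iota).
pose B : comAlgType k := alg_via (u \o iota).
have vZ (a : k) : {morph (v : A -> B) : x / a *: x}.
  by move=> x; rewrite !alg_viaZ rmorphM /= vE.
pose pi : {lrmorphism A -> B} :=
  @mk_lrmorphism k A B v (rmorphB v) (rmorphM v) (rmorph1 v) vZ.
have gB : {morph (u \o h : R -> B) : x y / x - y}.
  move=> x y /=; apply: (@addIr _ (u (h y))); rewrite subrK -rmorphD.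
  by rewrite -(ue _ _ (hD _ _)) subrK.
have gM : {morph (u \o h : R -> B) : x y / x * y}.
  by move=> x y /=; rewrite (ue _ _ (hM _ _)) rmorphM.
have g1 : (u \o h : R -> B) 1 = 1 by rewrite /= (ue _ _ h1) rmorph1.
have gZ a : {morph (u \o h : R -> B) : x / a *: x}.
  by move=> x; rewrite alg_viaZ /= (ue _ _ (hZ _ _)) rmorphM.
have [||t tE] := @smooth A B pi _ _ (@mk_lrmorphism k R B (u \o h) gB gM g1 gZ).
- by move=> d; have [x <-] := us d; exists (u' x); rewrite /= vE.
- move=> x y; have [x0 <-] := us' x; have [y0 <-] := us' y.
  rewrite /= !vE => /uker Ix /uker Iy.
  by rewrite -rmorphM; apply/uker'/II.
have [r rE] := choice us'.
have th x : u (r (t x)) = u (h x) by rewrite -vE rE; exact: (tE x).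
exists (r \o t); split=> /=.
- by move=> x y; apply: u'e; rewrite !rmorphD !rE.
- by move=> x y; apply: u'e; rewrite !rmorphM !rE.
- by move=> a x; apply: u'e; rewrite rmorphM !rE; exact: (linearZ_LR t a x).
- by apply: u'e; rewrite rE !rmorph1.
move=> x; rewrite -[RHS]hpi; apply/eqP; rewrite -subr_eq0 -rmorphB; apply/eqP/Ipi.
by apply/uker; rewrite rmorphB th subrr.
Qed.

(** For n >= 1 the ideal (g^n, gs) has its square inside (g^(n+1), gs), so the
   exponent of one generator can be raised one step at a time. *)
Lemma lift_mod_power (g : E) (gs : seq E) n :
  (forall x, gen (g :: gs) x -> ppi x = 0) ->
  (exists h, lift_mod (gen (g :: gs)) h) ->
  exists h, lift_mod (gen (g ^+ n.+1 :: gs)) h.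
Proof.
move=> gpi hg; elim: n => [|n IH]; first by rewrite expr1.
have sub m x : gen (g ^+ m.+2 :: gs) x -> gen (g ^+ m.+1 :: gs) x.
  apply: gen_sub => y; rewrite inE => /predU1P[->|ys].
    have [_ _ gM] := gen_ideal (g ^+ m.+1 :: gs).
    by rewrite [g ^+ m.+2]exprS; apply: (gM); apply: gen_mem; rewrite inE eqxx.
  by apply: gen_mem; rewrite inE ys orbT.
apply: lift_mod_step IH; [exact: gen_ideal|exact: gen_ideal|exact: sub| |].
  elim: n => [|n IHn] x; first by rewrite expr1; exact: gpi.
  by move/sub; apply: IHn.
move=> x y [r hr] [r' hr'].
have [g0 gD gM] := gen_ideal (g ^+ n.+2 :: gs).
(* The product of two elements of (g^(n+1), gs) has the term r r' g^(2n+2), a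
   multiple of g^(n+2). *)
have -> : x * y = x * (y - r' * g ^+ n.+1) + (r' * g ^+ n.+1) * (x - r * g ^+ n.+1)
   + (r * r' * g ^+ n) * g ^+ n.+2.
  have -> : r * r' * g ^+ n * g ^+ n.+2 = r * g ^+ n.+1 * (r' * g ^+ n.+1).
    by rewrite [RHS]mulrACA -mulrA -!exprD addSnnS.
  by rewrite !mulrBr addrA !(mulrC x) (mulrC _ (r * _)) subrK subrK.
apply: (gD); first apply: (gD).
- by apply: gM; apply: gen_tail.
- by apply: gM; apply: gen_tail.
- by apply: gM; apply: gen_mem; rewrite inE eqxx.
Qed.

(** Each generator of gs is nilpotent modulo G, so raising its exponent far
   enough removes it. *)
Lemma lift_mod_nil (gs G : seq E) n :
  (forall x, gen (gs ++ G) x -> ppi x = 0) -> (forall g, g \in gs -> gen G (g ^+ n.+1)) ->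
  (exists h, lift_mod (gen (gs ++ G)) h) -> exists h, lift_mod (gen G) h.
Proof.
elim: gs => [//|g gs IH] gpi gn /=.
move=> /(lift_mod_power n gpi) [h hh]; apply: IH.
- by move=> x /(gen_tail g) /gpi.
- by move=> g' g's; apply: gn; rewrite inE g's orbT.
exists h; apply: lift_mod_sub hh => x; apply: gen_sub => y.
rewrite inE => /predU1P[->|ys]; last exact: gen_mem.
apply: (@gen_sub _ G); last by apply: gn; rewrite inE eqxx.
by move=> z zG; apply: gen_mem; rewrite mem_cat zG orbT.
Qed.

End Lifting.

(** Equivalently, R is a finitely generated projective module over itself
   along x |-> x^q. *)
Definition frob_dual_basis (R : comNzRingType) (q : nat) : Prop :=
  exists (T : finType) (b : T -> R) (phi : T -> R -> R),
    (forall t, inv_frob_linear q (phi t)) /\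
    forall x, x = \sum_t phi t x ^+ q * b t.

(** Let h : R -> E be a lift of the identity along rc_pi, multiplicative
   modulo the relations.  Then h(r^q) = h(r)^q = r in E by rc_frob, so the
   coordinates of h are q^-1-linear, and rc_piE recovers x = rc_pi (h x) from
   them. *)
Theorem smooth_dual_basis (k : fieldType) (p f : nat) (R : comAlgType k)
    (I : finType) (s : I -> R) :
  perfect_of_char k p -> (0 < f)%N -> formally_smooth R ->
  presented (in_alg R) s -> frob_dual_basis R (p ^ f).
Proof.
move=> [ck kp] f0 smooth hs; set q := (p ^ f)%N.
have p1 : (1 < p)%N by exact/prime_gt1/(pcharf_prime ck).
have q1 : (1 < q)%N by rewrite -(exp1n f) ltn_exp2r.
have q0 : (0 < q)%N by exact: ltnW.
have cR : p \in [pchar R] by exact: (rmorph_pchar (in_alg R)).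
have Rq : qth_power_additive R q by apply: pchar_qadd.
have kq := perfect_qth_root f kp.
have [rho rhoE] := qth_root_exists q0 (pchar_qadd f ck) kq.
have nR := presented_noetherian hs.
have [E hE] := root_cover_exists f cR nR (codom s).
have pis x : exists e, rc_pi E e = x.
  have [r ->] := presented_digits q1 Rq kq hs x.
  have /choice[e eE] : forall i, exists e : E, rc_pi E e = s i.
    by move=> i; apply: hE; exact: codom_f.
  exists (\sum_g rc_in E (r g) * \prod_i e i ^+ g i).
  rewrite rmorph_sum; apply: eq_bigr => g _; rewrite rmorphM /= rc_piin; congr (_ * _).
  by rewrite rmorph_prod; apply: eq_bigr => i _; rewrite rmorphXn /= eE.
pose iota : {rmorphism k -> E} := rc_in E \o in_alg R \o rho.
pose J x := rc_pi E x = 0.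
have hJ : is_ideal J.
  split; rewrite /J; first exact: rmorph0.
    by move=> x y hx hy; rewrite rmorphD hx hy addr0.
  by move=> a x hx; rewrite rmorphM hx mulr0.
have [gs [gJ Jg]] := rc_noeth hJ.
have gsJ x : gen (gs ++ rc_rel E) x -> J x.
  apply: gen_min => // y; rewrite mem_cat => /orP[/gJ//|]; exact: rc_pirel.
have [h [hD hM hZ h1 hpi]] : exists h, lift_mod iota (rc_pi E) (gen (rc_rel E)) h.
  apply: (@lift_mod_nil _ _ _ _ _ smooth gs _ q.-1) => //.
    move=> g /gJ gJ0; rewrite prednK //.
    by have := rc_frob g; rewrite gJ0 rmorph0 subr0.
  have [h hE'] := choice pis.
  have JJ x : J x -> gen (gs ++ rc_rel E) x.
    move=> /Jg; apply: gen_sub => y ys; apply: gen_mem; by rewrite mem_cat ys.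
  exists h; split=> //.
  - by move=> x y; apply: JJ; rewrite /J rmorphB rmorphD !hE' subrr.
  - by move=> x y; apply: JJ; rewrite /J rmorphB rmorphM !hE' subrr.
  - move=> a x; apply: JJ; rewrite /J rmorphB rmorphM !hE' /= rc_piin.
    by rewrite exprZn rhoE expr1n mulr_algl subrr.
  - by apply: JJ; rewrite /J rmorphB rmorph1 hE' subrr.
have cB t x y : rc_coord t (x - y) = rc_coord t x - rc_coord t y :> R.
  by apply: (@addIr _ (rc_coord t y)); rewrite subrK -rc_coordD subrK.
have ce t x y : gen (rc_rel E) (x - y) -> rc_coord t x = rc_coord t y :> R.
  by move=> /(rc_coordI t)/eqP; rewrite cB subr_eq0 => /eqP.
exists (rc_idx E), (@rc_base _ _ _ E), (fun t x => rc_coord t (h x)).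
split; last by move=> x; rewrite -[LHS]hpi rc_piE.
have [g0 gD gM] := gen_ideal (rc_rel E).
have hX n x : gen (rc_rel E) (h (x ^+ n) - h x ^+ n).
  elim: n => [|n IH]; first by rewrite !expr0.
  rewrite !exprS -(subrK (h x * h (x ^+ n)) (h _)) -addrA -mulrBr.
  by apply: gD; [exact: hM | exact: gM].
move=> t; split=> [x y|r x]; first by rewrite (ce _ _ _ (hD x y)) rc_coordD.
rewrite -rc_coordZ; apply: ce.
rewrite -(subrK (h (r ^+ q) * h x) (h _)) -addrA -mulrBl.
apply: (gD); first exact: hM.
rewrite mulrC; apply: (gM).
rewrite -(subrK (h r ^+ q) (h (r ^+ q))) -addrA.
apply: (gD); first exact: hX.
by have := rc_frob (h r); rewrite hpi.
Qed.

(** * Presentations, dual bases of fields, and finitely generated subfields *)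

Lemma essentially_finite_presented (k : fieldType) (R : comAlgType k) :
  essentially_of_finite_type R ->
  exists (I : finType) (s : I -> R), presented (in_alg R) s.
Proof.
move=> [B [S [f [[l lP] [SM Su Sr _]]]]].
pose s (i : 'I_(size l)) := f l`_i.
pose P : {pred B} := fun b => `[< in_alg_of (in_alg R) s (f b) >].
have Pall b : in_alg_of (in_alg R) s (f b).
  suff : b \in P by move/asboolP.
  apply: lP.
    split; rewrite ?unfold_in.
    - by apply/asboolP; rewrite rmorph1; exact: alg_of1.
    - move=> a u v; rewrite !unfold_in => /asboolP hu /asboolP hv; apply/asboolP.
      have -> : f (a *: u + v) = a%:A * f u + f v.
        by rewrite rmorphD mulr_algl; congr (_ + _); exact: linearZ_LR.
      apply: alg_ofD => //; by apply: alg_ofM => //; exact: (alg_of_iota (in_alg R)).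
    - move=> u v; rewrite !unfold_in => /asboolP hu /asboolP hv; apply/asboolP.
      by rewrite rmorphM; apply: alg_ofM.
  move=> b0 /(nthP 0) [i ilt <-]; rewrite unfold_in; apply/asboolP.
  exact: (alg_of_gen (in_alg R) s (Ordinal ilt)).
exists 'I_(size l), s => r.
have [b [t [tS rt]]] := Sr r; have [u ut] := Su t tS.
by exists (f b), (f t), u; split.
Qed.

Section FieldDual.
Variables (K : fieldType) (q : nat).
Hypothesis Kq : qth_power_additive K q.

(** A shortest family that spans K over its q-th powers is a basis, and the
   coordinates in a basis are well defined and q^-1-linear. *)
Lemma field_dual_basis (T : finType) (l : T -> K) :
  (forall x, exists r : T -> K, x = \sum_t r t ^+ q * l t) ->
  frob_dual_basis K q.
Proof.
pose spans n (m : 'I_n -> K) :=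
  forall x, exists r : 'I_n -> K, x = \sum_i r i ^+ q * m i.
move=> hl.
have ex : exists n, `[< exists m, @spans n m >].
  exists #|T|; apply/asboolP; exists (fun i => l (enum_val i)) => x.
  have [r ->] := hl x; exists (fun i => r (enum_val i)).
  by rewrite (reindex _ (onW_bij _ (enum_val_bij T))).
case: (ex_minnP ex) => n /asboolP [m ms] hmin {T l hl}.
have free (r : 'I_n -> K) : \sum_i r i ^+ q * m i = 0 -> forall i, r i = 0.
  move=> r0 i; apply: contrapT => /eqP ri.
  case: n m ms hmin r r0 i ri {ex} => [|n] m ms hmin r r0 i ri; first by case: i {ri}.
  have : (n.+1 <= n)%N; last by rewrite ltnn.
  apply: hmin; apply/asboolP; exists (fun j => m (lift i j)) => x.
  have [c ->] := ms x; exists (fun j => c (lift i j) - c i / r i * r (lift i j)).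
  rewrite (bigD1_ord i) //= in r0 *; rewrite (bigD1_ord i) //=.
  under [RHS]eq_bigr => j _ do rewrite qth_powerB // mulrBl exprMn -mulrA.
  rewrite sumrB -big_distrr /= addrC -(addKr (r i ^+ q * m i) (\sum_(j < n) r _ ^+ q * _)) r0.
  by rewrite addr0 mulrN opprK expr_div_n mulrA divfK // expf_neq0.
have [phi phiE] := choice ms.
exists 'I_n, m, (fun i x => phi x i); split=> // i.
have uniq (r r' : 'I_n -> K) :
    \sum_i r i ^+ q * m i = \sum_i r' i ^+ q * m i -> forall i, r i = r' i.
  move=> e j; apply/eqP; rewrite -subr_eq0; apply/eqP.
  apply: (free (fun i => r i - r' i)).
  under eq_bigr => a _ do rewrite qth_powerB // mulrBl.
  by rewrite sumrB e subrr.
split=> [x y|r x].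
  apply: (uniq (phi (x + y)) (fun i => phi x i + phi y i)); rewrite -phiE.
  under eq_bigr => a _ do rewrite Kq mulrDl.
  by rewrite big_split /= -!phiE.
apply: (uniq (phi (r ^+ q * x)) (fun i => r * phi x i)); rewrite -phiE {1}(phiE x).
by rewrite big_distrr; apply: eq_bigr => a _ /=; rewrite exprMn mulrA.
Qed.

End FieldDual.

Section Subfield.
Variables (k : fieldType) (p : nat) (I : finType) (c : I -> k).
Hypothesis ck : p \in [pchar k].

Let iota0 : {rmorphism 'F_p -> k} := in_alg (pPrimeCharType ck) : {rmorphism 'F_p -> pPrimeCharType ck}.

Definition frac_pred : {pred k} :=
  fun x => `[< exists a b, [/\ in_alg_of iota0 c a, in_alg_of iota0 c b, b != 0 & x = a / b] >].

Fact frac_divring : divring_closed frac_pred.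
Proof.
split; rewrite ?unfold_in.
- by apply/asboolP; exists 1, 1; rewrite oner_eq0 divr1; split=> //; exact: alg_of1.
- move=> x y; rewrite !unfold_in => /asboolP[a [b [ha hb b0 ->]]] /asboolP[a' [b' [ha' hb' b'0 ->]]].
  apply/asboolP; exists (a * b' - a' * b), (b * b'); split.
  + apply: alg_ofD; first exact: alg_ofM.
    by apply: alg_ofN; apply: alg_ofM.
  + exact: alg_ofM.
  + by rewrite mulf_neq0.
  + by rewrite mulrBl; congr (_ - _); [|rewrite (mulrC b b')]; rewrite -mulf_div divff ?mulr1.
- move=> x y; rewrite !unfold_in => /asboolP[a [b [ha hb b0 ->]]] /asboolP[a' [b' [ha' hb' b'0 ->]]].
  apply/asboolP; have [a'0|a'0] := eqVneq a' 0.
    exists 0, 1; rewrite oner_eq0 a'0 mul0r invr0 mulr0 mul0r; split=> //.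
      exact: alg_of0.
    exact: alg_of1.
  exists (a * b'), (b * a'); split.
  + exact: alg_ofM.
  + exact: alg_ofM.
  + by rewrite mulf_neq0.
  + by rewrite invf_div mulf_div.
Qed.

HB.instance Definition _ := GRing.isDivringClosed.Build k frac_pred frac_divring.

Record frac_sub := FracSub { frac_val : k; _ : frac_val \in frac_pred }.
HB.instance Definition _ := [isSub for frac_val].
HB.instance Definition _ := [Choice of frac_sub by <:].
HB.instance Definition _ := [SubChoice_isSubIntegralDomain of frac_sub by <:].
HB.instance Definition _ := [SubIntegralDomain_isSubField of frac_sub by <:].

(** Take the fractions of elements of the F_p-algebra generated by c.  The
   coefficient field F_p of the presentation is finite, which is what makes
   the contraction principle give finite sets. *)
Lemma generated_subfield : exists (F : fieldType) (j : {rmorphism F -> k})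
    (iota : {rmorphism 'F_p -> F}) (s : I -> F),
  [/\ p \in [pchar F], forall i, j (s i) = c i & presented iota s].
Proof.
pose j : {rmorphism frac_sub -> k} :=
  @mk_rmorphism frac_sub k val (rmorphB val) (rmorphM val) (rmorph1 val).
have cF : p \in [pchar frac_sub].
  rewrite inE (pcharf_prime ck) /=; apply/eqP; apply: (fmorph_inj j).
  by rewrite rmorph_nat rmorph0 (pcharf0 ck).
pose iota : {rmorphism 'F_p -> frac_sub} :=
  in_alg (pPrimeCharType cF) : {rmorphism 'F_p -> pPrimeCharType cF}.
have cA i : c i \in frac_pred.
  rewrite unfold_in; apply/asboolP; exists (c i), 1.
  by rewrite oner_eq0 divr1; split=> //; [exact: alg_of_gen|exact: alg_of1].
pose s i : frac_sub := FracSub (cA i).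
have ij a : j (iota a) = iota0 a.
  by rewrite -[a]natr_Zp !rmorph_nat.
have lift a : in_alg_of iota0 c a -> exists a0, in_alg_of iota s a0 /\ j a0 = a.
  apply: (@alg_of_min _ _ iota0 _ c
     (fun a => exists a0, in_alg_of iota s a0 /\ j a0 = a)).
  - by move=> b; exists (iota b); split; [exact: alg_of_iota|exact: ij].
  - by move=> i; exists (s i); split; first exact: alg_of_gen.
  - move=> _ _ [x [xA <-]] [y [yA <-]]; exists (x + y).
    by split; [exact: alg_ofD|rewrite rmorphD].
  - move=> _ _ [x [xA <-]] [y [yA <-]]; exists (x * y).
    by split; [exact: alg_ofM|rewrite rmorphM].
exists frac_sub, j, iota, s; split=> // x.
have := valP x; rewrite unfold_in => /asboolP[_ [_ [/lift[a [aA <-]] /lift[b [bA <-]] b0 xE]]].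
have {}b0 : b != 0 by move: b0; rewrite fmorph_eq0.
exists a, b, b^-1; split=> //; first exact: mulVf.
by apply: (fmorph_inj j); rewrite rmorphM [j x]xE divfK // fmorph_eq0.
Qed.

End Subfield.

Lemma Fp_exp_pX p f (a : 'F_p) : prime p -> a ^+ (p ^ f) = a.
Proof.
move=> pp; elim: f => [|f IH]; first by rewrite expr1.
have ap : a ^+ p = a by have := expf_card a; rewrite card_Fp.
by rewrite expnS exprM ap.
Qed.

Lemma Fp_qth_root p f (a : 'F_p) : prime p -> exists b : 'F_p, b ^+ (p ^ f) = a.
Proof. by exists a; apply: Fp_exp_pX. Qed.

(** * Semilinear systems: annihilators over a finitely generated field *)

Section Words.
Variables (k : fieldType) (rho : {rmorphism k -> k}).

Section OneSystem.
Variables (L X : finType) (beta : L -> X -> X -> k).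

(** With rho x = x^(1/q) this is the q^-1-linear operator z |-> (z
   beta_c)^(1/q). *)
Definition letter_op (c : L) (z : X -> k) : X -> k :=
  fun x => rho (\sum_y z y * beta c y x).

Definition word_op (w : seq L) (z : X -> k) : X -> k :=
  foldl (fun z c => letter_op c z) z w.

Definition unit_vec (x0 : X) : X -> k := fun x => (x == x0)%:R.

Lemma word_op_rcons w c z : word_op (rcons w c) z = letter_op c (word_op w z).
Proof. by rewrite /word_op -cats1 foldl_cat. Qed.

Lemma word_op_cat w w' z : word_op (w ++ w') z = word_op w' (word_op w z).
Proof. by rewrite /word_op foldl_cat. Qed.

End OneSystem.

Section Annihilators.
Variables (F : fieldType) (j : {rmorphism F -> k}) (p f : nat).
Local Notation q := (p ^ f)%N.
Hypotheses (f0 : (0 < f)%N) (ck : p \in [pchar k])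
  (rhoE : forall x, rho x ^+ q = x).
Variables (iota : {rmorphism 'F_p -> F}) (I : finType) (s : I -> F).
Hypotheses (cF : p \in [pchar F]) (hs : presented iota s).

Let pp : prime p. Proof. exact: pcharf_prime ck. Qed.
Let q1 : (1 < q)%N. Proof. by rewrite -(exp1n f) ltn_exp2r // prime_gt1. Qed.
Let q0 : (0 < q)%N. Proof. exact: ltnW. Qed.
Let kq : qth_power_additive k q. Proof. exact: pchar_qadd. Qed.
Let Fq : qth_power_additive F q. Proof. exact: pchar_qadd. Qed.

Definition kills (L X : finType) (beta : L -> X -> X -> F) (S0 : {set X})
    (e : nat) (zeta : X -> F) : Prop :=
  forall w x0, size w = e -> x0 \in S0 ->
    \sum_x j (zeta x) *
       word_op (fun c y x => j (beta c y x)) w (unit_vec x0) x = 0.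

Lemma rho_eq0 x : rho x = 0 <-> x = 0.
Proof. by split=> [h|->]; [rewrite -(rhoE x) h expr0n eqn0Ngt q0|rewrite rmorph0]. Qed.

Lemma rhoX x : rho (x ^+ q) = x.
Proof. by rewrite rmorphXn rhoE. Qed.

(** Whether zeta vanishes on words of length e+1 is decided by whether the
   forms y |-> sum_x zeta(x)^q beta c y x vanish on words of length e.  A
   Frobenius dual basis of F rewrites this backward recursion on forms as a
   forward recursion u |-> phi_t (u beta_c) on vectors over F: a form vanishes
   on all words of length e if and only if it vanishes on the set U e of such
   vectors.  By contraction over F_p the vectors in question have coordinates
   in a fixed finite set, so U e is one of finitely many sets. *)
Lemma annihilators_finite (L X : finType) (beta : L -> X -> X -> F) (S0 : {set X}) :
  exists (Th : finType) (cls : nat -> Th), forall e e', cls e = cls e' ->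
    forall zeta, kills beta S0 e zeta -> kills beta S0 e' zeta.
Proof.
have [T [b [phi [phiP phiE]]]] : frob_dual_basis F q.
  apply: (field_dual_basis Fq (l := @digit_mono F I s q)).
  by apply: (presented_digits q1 Fq _ hs) => a; apply: Fp_qth_root.
pose psi (i : T * L * X * X) (u : F) := phi i.1.1.1 (u * beta i.1.1.2 i.1.2 i.2).
have psiP i : inv_frob_linear q (psi i).
  split=> [x y|r x]; first by rewrite /psi mulrDl (phiP _).1.
  by rewrite /psi -mulrA (phiP _).2.
have [H [wH [h1 [wh1 hkap]]]] :=
  contraction q1 Fq (fun a => Fp_qth_root f a pp) hs psiP.
have /choice [kap kapE] : forall ih : (T * L * X * X) * H, exists kap : H -> 'F_p,
  psi ih.1 (wH ih.2) = \sum_h' iota (kap h') * wH h' by case=> i h; apply: hkap.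
pose V := {ffun X -> {ffun H -> 'F_p}}.
pose gam (u : V) (x : X) : F := \sum_h iota (u x h) * wH h.
(* The forward step u |-> phi_t (u beta_c), in coordinates over F_p. *)
pose st (tc : T * L) (u : V) : V :=
  [ffun x => [ffun h' => \sum_y \sum_h u y h * kap ((tc, y, x), h) h']].
have iq (a : 'F_p) : iota a ^+ q = iota a by rewrite -rmorphXn /= Fp_exp_pX.
have stE t c u x : gam (st (t, c) u) x = phi t (\sum_y gam u y * beta c y x).
  rewrite (inv_frob_sum (phiP t)) /gam.
  under eq_bigr => h' _ do rewrite !ffunE rmorph_sum big_distrl /=.
  rewrite exchange_big /=; apply: eq_bigr => y _.
  rewrite big_distrl /= (inv_frob_sum (phiP t)).
  under eq_bigr => h' _ do rewrite rmorph_sum big_distrl /=.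
  rewrite exchange_big /=; apply: eq_bigr => h _.
  rewrite -mulrA -{1}(iq (u y h)) (phiP t).2.
  rewrite -[phi t _]/(psi (t, c, y, x) (wH h)) (kapE ((t, c, y, x), h)).
  by rewrite big_distrr; apply: eq_bigr => h' _ /=; rewrite rmorphM mulrA.
pose u0 (x0 : X) : V := [ffun x => [ffun h => ((x == x0) && (h == h1))%:R]].
have u0E x0 x : gam (u0 x0) x = (x == x0)%:R.
  rewrite /gam (bigD1 h1) //= !ffunE eqxx andbT wh1 mulr1 big1 ?addr0 ?rmorph_nat //.
  by move=> h /negPf hn; rewrite !ffunE hn andbF rmorph0 mul0r.
pose U := fix U e : {set V} := if e is e'.+1
  then [set st tc u | tc in [set: T * L], u in U e'] else [set u0 x | x in S0].
suff main e zeta : kills beta S0 e zeta <->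
    forall u, u \in U e -> \sum_x zeta x * gam u x = 0.
  by exists {set V}, U => e e' ee' zeta /main h; apply/main; rewrite -ee'.
elim: e zeta => [|e IH] zeta.
  split=> [h u /imsetP[x0 x0S ->]|h w x0 /size0nil -> x0S].
    have := h [::] x0 erefl x0S; rewrite (bigD1 x0) //= /unit_vec eqxx mulr1 big1 ?addr0.
      move=> j0; rewrite (bigD1 x0) //= u0E eqxx mulr1 big1 ?addr0.
        by apply: (fmorph_inj j); rewrite j0 rmorph0.
      by move=> x /negPf hx; rewrite u0E hx mulr0.
    by move=> x /negPf ->; rewrite mulr0.
  have := h (u0 x0) (imset_f _ x0S).
  rewrite (bigD1 x0) //= u0E eqxx mulr1 big1 ?addr0.
    move=> z0; rewrite (bigD1 x0) //= /unit_vec eqxx mulr1 z0 rmorph0 add0r big1 //.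
    by move=> x /negPf ->; rewrite mulr0.
  by move=> x /negPf hx; rewrite u0E hx mulr0.
(* The last letter c pulls zeta back to zeta' c, raised to the power q. *)
pose zeta' c y := \sum_x zeta x ^+ q * beta c y x.
have step1 : kills beta S0 e.+1 zeta <-> forall c, kills beta S0 e (zeta' c).
  have E w c x0 :
      \sum_x j (zeta x) * word_op (fun c y x => j (beta c y x)) (rcons w c) (unit_vec x0) x
    = rho (\sum_y j (zeta' c y) * word_op (fun c y x => j (beta c y x)) w (unit_vec x0) y).
    rewrite word_op_rcons /letter_op.
    under eq_bigr => x _ do rewrite -[j (zeta x)]rhoX -rmorphM big_distrr.
    rewrite -rmorph_sum exchange_big /=; congr (rho _); apply: eq_bigr => y _.
    rewrite /zeta' rmorph_sum big_distrl; apply: eq_bigr => x _ /=.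
    by rewrite rmorphM rmorphXn /= mulrCA mulrC.
  split=> [h c w x0 we x0S|h w x0].
    by apply/rho_eq0; rewrite -E; apply: h; rewrite ?size_rcons ?we.
  case/lastP: w => // w c; rewrite size_rcons => -[we] x0S.
  by rewrite E; apply/rho_eq0/h.
rewrite step1; split=> [h u /imset2P[[t c] u' _ u'U ->]|h c].
  have /IH/(_ u' u'U) := h c => h0.
  under eq_bigr => x _ do rewrite stE -(phiP t).2.
  rewrite -(inv_frob_sum (phiP t)) -[RHS](inv_frob0 (phiP t)); congr (phi t _).
  rewrite -[RHS]h0 /zeta'.
  under [RHS]eq_bigr => y _ do rewrite big_distrl /=.
  rewrite [RHS]exchange_big; apply: eq_bigr => x _ /=.
  rewrite big_distrr; apply: eq_bigr => y _ /=.
  by rewrite mulrCA mulrC.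
apply/IH => u uU; rewrite /zeta'.
under eq_bigr => y _ do rewrite big_distrl /=.
rewrite exchange_big /=.
transitivity (\sum_x \sum_t (zeta x * gam (st (t, c) u) x) ^+ q * b t).
  apply: eq_bigr => x _.
  under [RHS]eq_bigr => t _ do rewrite exprMn stE -mulrA.
  rewrite -big_distrr -phiE big_distrr; apply: eq_bigr => y _ /=.
  by rewrite mulrCA mulrC.
rewrite exchange_big big1 // => t _.
rewrite -big_distrl /= -(qth_power_sum q0 Fq) h ?expr0n ?eqn0Ngt ?q0 ?mul0r //.
by apply: imset2_f; rewrite ?inE.
Qed.

End Annihilators.
End Words.

(** * Semilinear systems: a uniform bound for the jumps *)

Section Tensor.
Variables (k : fieldType) (rho : {rmorphism k -> k}).
Variables (L X : finType) (beta : L -> X -> X -> k) (d : nat).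

(** The Kronecker product: its system is the d-th tensor power of the given
   one. *)
Definition tensor_mx (T : comNzRingType) (b : L -> X -> X -> T)
  (c : {ffun 'I_d -> L}) (y x : {ffun 'I_d -> X}) : T := \prod_i b (c i) (y i) (x i).

(** By distributivity the sum over all multi-indices of a product is the
   product of the sums. *)
Lemma word_op_tensor (w : seq {ffun 'I_d -> L}) (z : 'I_d -> X -> k) x :
  word_op rho (tensor_mx beta) w (fun y => \prod_i z i (y i)) x =
  \prod_i word_op rho beta [seq c i | c : {ffun 'I_d -> L} <- w] (z i) (x i).
Proof.
elim: w z x => //= c w IH z x.
rewrite -IH; congr (word_op _ _ _ _ _); apply/funext => y.
rewrite /letter_op -rmorph_prod; congr (rho _).
rewrite bigA_distr_bigA; apply: eq_bigr => g _ /=.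
by rewrite /tensor_mx -big_split.
Qed.

Lemma unit_vec_tensor (x0 y : {ffun 'I_d -> X}) :
  unit_vec k x0 y = \prod_i unit_vec k (x0 i) (y i).
Proof.
rewrite /unit_vec; have [->|yx] := eqVneq y x0.
  by rewrite big1 // => i _; rewrite eqxx.
have [i yi] : exists i, y i != x0 i.
  apply/existsP; rewrite -negb_forall; apply: contraNN yx => /forallP h.
  by apply/eqP/ffunP => i; apply/eqP.
by rewrite (bigD1 i) //= (negPf yi) mul0r.
Qed.

End Tensor.

Section Jump.
Variables (k : fieldType) (rho : {rmorphism k -> k}) (q : nat).
Variables (L X : finType) (beta : L -> X -> X -> k) (S0 : {set X}) (dg : L -> nat).

(** The number with q-adic digits dg c, the letter that acts first giving the
   lowest digit. *)
Definition word_value (w : seq L) : nat := foldr (fun c n => (dg c + q * n)%N) 0%N w.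

(** The linear span, as the intersection of all subspaces; this form
   transports well along semilinear maps. *)
Definition kspan (A : (X -> k) -> Prop) (v : X -> k) : Prop :=
  forall P : (X -> k) -> Prop, P (fun=> 0) ->
    (forall c z z', P z -> P z' -> P (fun x => c * z x + z' x)) ->
    (forall z, A z -> P z) -> P v.

Definition reached (m e a : nat) (v : X -> k) : Prop :=
  exists w al x0, [/\ size w = e, size al = m, word_value al = a, x0 \in S0 &
    v = word_op rho beta (w ++ al) (unit_vec k x0)].

Definition jump (m e a : nat) : Prop :=
  exists v, reached m e a v /\
    ~ kspan (fun z => exists2 a', (a' < a)%N & reached m e a' z) v.

End Jump.

Lemma row_free_minor (K : fieldType) d n (M : 'M[K]_(d, n)) :
  row_free M <-> exists x : 'I_d -> 'I_n, \det (colsub x M) != 0.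
Proof.
split=> [fM|[x dx]].
  have rM : row_full M^T by rewrite /row_full mxrank_tr.
  exists (fullrankfun rM).
  have : rowsub (fullrankfun rM) M^T \in unitmx by rewrite -row_full_unit; apply: fullrowsub_full.
  rewrite unitmxE unitfE -det_tr => h.
  by rewrite (_ : colsub _ M = (rowsub (fullrankfun rM) M^T)^T) //; apply/matrixP => a b; rewrite !mxE.
rewrite -row_leq_rank -{1}(mxrank_unit (_ : colsub x M \in unitmx)) ?unitmxE ?unitfE //.
by rewrite -[M in colsub x M]mulmx1 -mulmx_colsub mxrankM_maxl.
Qed.

Section Jumps.
Variables (k : fieldType) (rho : {rmorphism k -> k}) (p f : nat).
Local Notation q := (p ^ f)%N.
Hypotheses (f0 : (0 < f)%N) (ck : p \in [pchar k])
  (rhoE : forall x, rho x ^+ q = x).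
Variables (F : fieldType) (j : {rmorphism F -> k}).
Variables (iota : {rmorphism 'F_p -> F}) (I : finType) (s : I -> F).
Hypotheses (cF : p \in [pchar F]) (hs : presented iota s).
Variables (L X : finType) (betaF : L -> X -> X -> F) (S0 : {set X}).
Let beta c y x := j (betaF c y x).
Local Notation wop := (word_op rho beta).
Local Notation uv := (unit_vec k).

Definition multi_kills (d e : nat) (zeta : {ffun 'I_d -> X} -> F) : Prop :=
  forall (w : 'I_d -> seq L) (x0 : 'I_d -> X),
    (forall i, size (w i) = e) -> (forall i, x0 i \in S0) ->
    \sum_g j (zeta g) * \prod_i wop (w i) (uv (x0 i)) (g i) = 0.

(** A multilinear form on d-tuples of words is a linear form on words of the
   d-th tensor power: d words of the same length are read as one word whose
   letters are d-tuples. *)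
Lemma multi_killsP d e (zeta : {ffun 'I_d -> X} -> F) :
  multi_kills e zeta <->
  kills rho j (tensor_mx betaF) [set g : {ffun 'I_d -> X} | [forall i, g i \in S0]] e zeta.
Proof.
have E (w : seq {ffun 'I_d -> L}) (x0 : {ffun 'I_d -> X}) g :
    word_op rho (fun c y x => j (tensor_mx betaF c y x)) w (unit_vec k x0) g =
    \prod_i wop [seq c i | c : {ffun 'I_d -> L} <- w] (uv (x0 i)) (g i).
  have -> : (fun c y x => j (tensor_mx betaF c y x)) = @tensor_mx L X d k beta.
    by apply/funext => c; apply/funext => y; apply/funext => x; rewrite /tensor_mx rmorph_prod.
  have -> : unit_vec k x0 = fun y => \prod_i unit_vec k (x0 i) (y i).
    by apply/funext => y; rewrite unit_vec_tensor.
  exact: word_op_tensor.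
split=> [h w x0 we|h w x0 we x0S].
  rewrite inE => /forallP x0S.
  under eq_bigr => g _ do rewrite E.
  by apply: h => // i; rewrite size_map.
pose t i : e.-tuple L := Tuple (introT eqP (we i)).
pose W := [seq [ffun i => tnth (t i) a] | a <- enum 'I_e] : seq {ffun 'I_d -> L}.
have WE i : [seq c i | c : {ffun 'I_d -> L} <- W] = w i.
  rewrite -map_comp -[RHS]/(tval (t i)) -[RHS]map_tnth_enum.
  by apply: eq_map => a; rewrite /= ffunE.
have := h W [ffun i => x0 i]; rewrite size_map size_enum_ord => /(_ erefl).
rewrite inE => h'; rewrite -[RHS]h'; last by apply/forallP => i; rewrite ffunE.
apply: eq_bigr => g _; rewrite E; congr (_ * _); apply: eq_bigr => i _.
by rewrite WE ffunE.
Qed.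

(** The classes of [annihilators_finite] for the tensor powers of degree less
   than D, taken together. *)
Lemma multi_annihilators_finite D :
  exists (Th : finType) (cls : nat -> Th), forall e e', cls e = cls e' ->
    forall d (zeta : {ffun 'I_d -> X} -> F), (d < D)%N ->
    multi_kills e zeta -> multi_kills e' zeta.
Proof.
elim: D => [|D [Th [cls clsP]]]; first by exists unit, (fun=> tt).
have [Th' [cls' clsP']] := annihilators_finite j f0 ck rhoE cF hs
  (@tensor_mx L X D F betaF) [set g : {ffun 'I_D -> X} | [forall i, g i \in S0]].
exists (Th * Th')%type, (fun e => (cls e, cls' e)) => e e' [c c'] d zeta.
rewrite ltnS leq_eqVlt => /predU1P[dD|]; last exact: clsP.
by subst d; move/multi_killsP => h; apply/multi_killsP; apply: clsP' h.
Qed.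

(** Raising to the power q^m makes a word of length m linear, with matrix
   entries in F. *)
Lemma word_op_power al : exists B : X -> X -> F, forall z x,
  wop al z x ^+ (q ^ size al) = \sum_y z y * j (B y x).
Proof.
elim/last_ind: al => [|al c [B BE]].
  exists (fun y x => (y == x)%:R) => z x; rewrite expr1.
  rewrite (bigD1 x) //= eqxx rmorph1 mulr1 big1 ?addr0 // => y /negPf ->.
  by rewrite rmorph0 mulr0.
exists (fun y x => \sum_v B y v * betaF c v x ^+ (q ^ size al)) => z x.
rewrite word_op_rcons size_rcons expnS exprM /letter_op rhoE.
have kq : qth_power_additive k (q ^ size al).
  by rewrite -expnM; apply: pchar_qadd.
have q0 : (0 < q ^ size al)%N by rewrite !expn_gt0 (prime_gt0 (pcharf_prime ck)).
rewrite (qth_power_sum q0 kq).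
under eq_bigr => v _ do rewrite exprMn BE big_distrl /=.
rewrite exchange_big /=; apply: eq_bigr => y _.
rewrite rmorph_sum big_distrr; apply: eq_bigr => v _ /=.
by rewrite rmorphM rmorphXn /= mulrA.
Qed.

(** A minor of the vectors al_i (z_i) is, up to a power, a multilinear form in
   the z_i with coefficients in F, by expansion of the determinant. *)
Lemma det_word_power d m (al : 'I_d -> seq L) (x : 'I_d -> X) :
  (forall i, size (al i) = m) ->
  exists zeta : {ffun 'I_d -> X} -> F, forall z : 'I_d -> X -> k,
    (\det (\matrix_(i, l) wop (al i) (z i) (x l))) ^+ (q ^ m) =
    \sum_g j (zeta g) * \prod_i z i (g i).
Proof.
move=> am; have /choice [B BE] := fun i => word_op_power (al i).
exists (fun g => \det (\matrix_(i, l) B i (g i) (x l))) => z.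
have kq : qth_power_additive k (q ^ m) by rewrite -expnM; apply: pchar_qadd.
have FB : {morph (fun x : k => x ^+ (q ^ m)) : x y / x - y}.
  by move=> a b; apply: qth_powerB.
have FM : {morph (fun x : k => x ^+ (q ^ m)) : x y / x * y}.
  by move=> a b; apply: exprMn.
pose Fr := mk_rmorphism FB FM (expr1n k _).
rewrite -[LHS]/(Fr _) -det_map_mx.
under [RHS]eq_bigr => g _ do rewrite -det_map_mx /determinant big_distrl /=.
rewrite exchange_big /=; apply: eq_bigr => pi _.
have E i : (map_mx Fr (\matrix_(i, l) wop (al i) (z i) (x l))) i ((pi : {perm 'I_d}) i) =
    \sum_y z i y * j (B i y (x ((pi : {perm 'I_d}) i))).
  by rewrite !mxE -BE am.
rewrite (eq_bigr _ (fun i _ => E i)) bigA_distr_bigA big_distrr /=.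
apply: eq_bigr => g _; rewrite -mulrA; congr (_ * _).
by rewrite -big_split; apply: eq_bigr => i _ /=; rewrite !mxE mulrC.
Qed.

Variable dg : L -> nat.
Local Notation word_value := (word_value q dg).
Local Notation jump := (jump rho q beta S0 dg).

Definition indep (d e m a : nat) : Prop :=
  exists (w al : 'I_d -> seq L) (x0 : 'I_d -> X),
    [/\ forall i, size (w i) = e, forall i, size (al i) = m,
        forall i, (word_value (al i) < a)%N, forall i, x0 i \in S0 &
        row_free (\matrix_(i < d, x < #|X|) wop (w i ++ al i) (uv (x0 i)) (enum_val x))].

(** By [det_word_power] independence on words of length e means that some
   form, from a family that does not depend on e, does not vanish on them. *)
Lemma indep_class d e e' m a :
  (forall zeta : {ffun 'I_d -> X} -> F, multi_kills e' zeta -> multi_kills e zeta) ->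
  indep d e m a -> indep d e' m a.
Proof.
move=> kk [w [al [x0 [we am aa xS /row_free_minor[x dx]]]]].
have [zeta zE] := det_word_power (fun i => enum_val (x i)) am.
have dE (w' : 'I_d -> seq L) (y0 : 'I_d -> X) :
    (\det (colsub x (\matrix_(i < d, x < #|X|) wop (w' i ++ al i) (uv (y0 i)) (enum_val x)))) ^+ (q ^ m)
    = \sum_g j (zeta g) * \prod_i wop (w' i) (uv (y0 i)) (g i).
  rewrite -(zE (fun i => wop (w' i) (uv (y0 i)))); congr (\det _ ^+ _); apply/matrixP => a1 a2.
  by rewrite !mxE word_op_cat.
have q0 : (0 < q ^ m)%N by rewrite !expn_gt0 (prime_gt0 (pcharf_prime ck)).
have : ~ multi_kills e' zeta.
  move=> /kk /(_ w x0 we xS); rewrite -dE => /eqP.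
  by rewrite expf_eq0 q0 (negPf dx).
move=> nk; apply: contrapT => ni; apply: nk => w' y0 we' yS.
rewrite -dE; apply/eqP; rewrite expf_eq0 q0 /=; apply: contrapT => /negP d0.
apply: ni; exists w', al, y0; split=> //.
by apply/row_free_minor; exists x.
Qed.

Lemma indep_mono d e m a a' : (a <= a')%N -> indep d e m a -> indep d e m a'.
Proof.
move=> aa' [w [al [x0 [we am aa xS fr]]]]; exists w, al, x0; split=> // i.
exact: leq_trans aa'.
Qed.

Lemma indep_le d e m a : indep d e m a -> (d <= #|X|)%N.
Proof.
move=> [w [al [x0 [_ _ _ _ fr]]]]; rewrite -(eqP fr); exact: rank_leq_col.
Qed.

(** Take d - 1 to be the rank of the span of the words with top value less
   than a; the jump provides one more independent vector. *)
Lemma jump_indep m e a : jump m e a ->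
  exists d, [/\ (d <= #|X|)%N, indep d e m a.+1 & ~ indep d e m a].
Proof.
move=> [v [[w [al [x0 [we am aE xS vE]]]] /existsNP[P]]].
move=> /not_implyP[P0 /not_implyP[Pc /not_implyP[PA Pv]]].
have ex : exists d, `[< indep d e m a >].
  exists 0%N; apply/asboolP; exists (fun=> [::]), (fun=> [::]), (fun=> x0).
  by split; [case|case|case|case|rewrite /row_free flatmx0 mxrank0].
have bd d : `[< indep d e m a >] -> (d <= #|X|)%N by move=> /asboolP/indep_le.
case: (ex_maxnP ex bd) => d /asboolP hd hmax.
have ni : ~ indep d.+1 e m a by move=> /asboolP/hmax; rewrite ltnn.
suff hi : indep d.+1 e m a.+1.
  by exists d.+1; split=> //; exact: indep_le hi.
have [w' [al' [y0 [we' am' aa' yS fr]]]] := hd.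
exists (fun i => oapp w' w (unlift ord0 i)), (fun i => oapp al' al (unlift ord0 i)),
  (fun i => oapp y0 x0 (unlift ord0 i)); split.
- by move=> i; case: unliftP => [i' _|_] /=.
- by move=> i; case: unliftP => [i' _|_] /=.
- by move=> i; case: unliftP => [i' _|_] /=; rewrite ?aE // ltnS ltnW.
- by move=> i; case: unliftP => [i' _|_] /=.
apply: inj_row_free => u; set M := (X in u *m X) => uM.
have E x : u 0 ord0 * v x + \sum_i u 0 (lift ord0 i) * wop (w' i ++ al' i) (uv (y0 i)) x = 0.
  have := congr1 (fun N : 'rV_ _ => N 0 (enum_rank x)) uM; rewrite !mxE => uMx.
  rewrite -[RHS]uMx big_ord_recl; congr (_ + _); first by rewrite !mxE unlift_none enum_rankK /= vE.
  by apply: eq_bigr => i _; rewrite !mxE liftK enum_rankK.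
have u0 : u 0 ord0 = 0.
  apply: contrapT => /eqP u0; apply: Pv.
  have Ps (I0 : Type) (r : seq I0) (c : I0 -> k) (z : I0 -> X -> k) :
      (forall i, P (z i)) -> P (fun x => \sum_(i <- r) c i * z i x).
    move=> Pz; elim: r => [|i r IH].
      by rewrite (_ : (fun x => _) = (fun=> 0)) //; apply/funext => x; rewrite big_nil.
    rewrite (_ : (fun x => _) = (fun x => c i * z i x + \sum_(i <- r) c i * z i x)); last first.
      by apply/funext => x; rewrite big_cons.
    exact: Pc.
  have -> : v = fun x => \sum_i (- (u 0 ord0)^-1 * u 0 (lift ord0 i)) * wop (w' i ++ al' i) (uv (y0 i)) x.
    apply/funext => x.
    under eq_bigr => i _ do rewrite -mulrA.
    rewrite -big_distrr /= -(addKr (u 0 ord0 * v x) (\sum_i _)) E addr0 mulrNN.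
    by rewrite mulKf.
  apply: Ps => i; apply: PA; exists (word_value (al' i)) => //.
  by exists (w' i), (al' i), (y0 i).
have uM' : (\row_i u 0 (lift ord0 i)) *m
   (\matrix_(i < d, x < #|X|) wop (w' i ++ al' i) (uv (y0 i)) (enum_val x)) = 0.
  apply/rowP => x; rewrite !mxE -[RHS](E (enum_val x)) u0 mul0r add0r.
  by apply: eq_bigr => i _; rewrite !mxE.
move/eqP: uM'; rewrite mulmx_free_eq0 // => /eqP uM'.
apply/rowP => i; rewrite mxE; case: (unliftP ord0 i) => [i' ->|-> //].
by have /rowP/(_ i') := uM'; rewrite !mxE.
Qed.

(** For a fixed class of e and a fixed d at most one a satisfies the
   conclusion of [jump_indep], since indep is monotone in a.  So the pair of
   the class and of d <= #|X| determines the jump. *)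
Lemma jumps_bounded_field : exists K : nat, forall m, exists sa : seq nat,
  (size sa <= K)%N /\ forall e a, jump m e a -> a \in sa.
Proof.
have [Th [cls clsP]] := multi_annihilators_finite #|X|.+1.
have icls e e' d m a : (d <= #|X|)%N -> cls e = cls e' -> indep d e m a -> indep d e' m a.
  by move=> dX ee; apply: indep_class => zeta; apply: clsP; rewrite ?ltnS.
exists #|{: Th * 'I_#|X|.+1}| => m.
(* At most one a is attached to a class and a rank. *)
pose Q (td : Th * 'I_#|X|.+1) a := exists e, [/\ cls e = td.1,
  indep td.2 e m a.+1 & ~ indep td.2 e m a].
have /choice [g gP] : forall td, exists a, forall a', Q td a' -> a' = a.
  move=> [t d]; have [[a [e [et h1 h2]]]|h] := pselect (exists a, Q (t, d) a); last first.
    by exists 0%N => a Qa; case: h; exists a.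
  exists a => a' [e' [et' h1' h2']].
  have ee : cls e = cls e' by rewrite et et'.
  have dX : (d <= #|X|)%N by rewrite -ltnS.
  apply/eqP; rewrite eqn_leq; apply/andP; split; rewrite leqNgt; apply/negP => lt.
    by apply: h2'; apply: indep_mono lt _; exact: icls h1.
  by apply: h2; apply: indep_mono lt _; apply: icls h1'.
exists (codom g); rewrite size_codom; split=> // e a /jump_indep[d [dX h1 h2]].
apply/codomP; exists (cls e, inord d); apply: gP; exists e.
by split=> //=; rewrite inordK.
Qed.

End Jumps.

(** All matrix entries lie in a finitely generated subfield, where
   [jumps_bounded_field] applies. *)
Theorem jumps_bounded (k : fieldType) (rho : {rmorphism k -> k}) (p f : nat)
    (L X : finType) (beta : L -> X -> X -> k) (S0 : {set X}) (dg : L -> nat) :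
  (0 < f)%N -> p \in [pchar k] -> (forall x, rho x ^+ (p ^ f) = x) ->
  exists K : nat, forall m, exists sa : seq nat, (size sa <= K)%N /\
    forall e a, jump rho (p ^ f) beta S0 dg m e a -> a \in sa.
Proof.
move=> f0 ck rhoE.
have [F [j [iota [s [cF sE hs]]]]] :=
  generated_subfield (fun i : L * X * X => beta i.1.1 i.1.2 i.2) ck.
have -> : beta = fun c y x => j (s (c, y, x)).
  by apply/funext => c; apply/funext => y; apply/funext => x; rewrite sE.
exact: (@jumps_bounded_field k rho p f f0 ck rhoE F j iota _ s cF hs).
Qed.

(** * Accumulation points of digit expansions *)

Local Open Scope classical_set_scope.
Local Open Scope ring_scope.

Section WordJumps.
Variables (k : fieldType) (rho : {rmorphism k -> k}) (q : nat).
Variables (L X : finType) (beta : L -> X -> X -> k) (S0 : {set X}) (dg : L -> nat).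
Hypotheses (q0 : (0 < q)%N) (dgq : forall c, (dg c < q)%N).
Local Notation wop := (word_op rho beta).
Local Notation wval := (word_value q dg).

Definition word_vec (E n : nat) (v : X -> k) : Prop :=
  exists w x0, [/\ size w = E, wval w = n, x0 \in S0 & v = wop w (unit_vec k x0)].

Definition word_jump (E n : nat) : Prop :=
  exists v, word_vec E n v /\
    ~ kspan (fun z => exists2 n', (n' < n)%N & word_vec E n' z) v.

Lemma word_value_cat w w' : wval (w ++ w') = (wval w + q ^ size w * wval w')%N.
Proof.
elim: w => [|c w IH] /=; first by rewrite mul1n.
by rewrite IH expnS mulnDr addnA mulnA.
Qed.

Lemma word_value_lt w : (wval w < q ^ size w)%N.
Proof.
elim: w => [//|c w IH] /=; rewrite expnS.
have : (q * (wval w).+1 <= q * q ^ size w)%N by rewrite leq_mul2l IH orbT.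
by rewrite mulnS; apply: leq_trans; rewrite -addSn leq_add2r.
Qed.

Lemma kspan_sub (A B : (X -> k) -> Prop) v :
  (forall z, A z -> B z) -> kspan A v -> kspan B v.
Proof. by move=> AB hA P P0 Pc PB; apply: hA => // z /AB; apply: PB. Qed.

Lemma word_jump_lt E n : word_jump E n -> (n < q ^ E)%N.
Proof. by move=> [v [[w [x0 [<- <- _ _]]] _]]; apply: word_value_lt. Qed.

(** A word of length E is a word of length E - m, which contributes the low
   digits, followed by a word of length m, which contributes the top digits.
   *)
Lemma word_jump_top E n m : (m <= E)%N -> word_jump E n ->
  jump rho q beta S0 dg m (E - m) (n %/ q ^ (E - m)).
Proof.
move=> mE [v [[w [x0 [wE wn xS vE]]] nv]].
set e := (E - m)%N.
have se : size (take e w) = e by rewrite size_takel // wE leq_subr.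
have sm : size (drop e w) = m by rewrite size_drop wE subKn.
have vn : n = (wval (take e w) + q ^ e * wval (drop e w))%N.
  by rewrite -wn -[in LHS](cat_take_drop e w) word_value_cat se.
have qe0 : (0 < q ^ e)%N by rewrite expn_gt0 q0.
have lt : (wval (take e w) < q ^ e)%N by rewrite -[X in (_ < q ^ X)%N]se word_value_lt.
have aE : (n %/ q ^ e)%N = wval (drop e w).
  by rewrite vn addnC mulnC divnMDl // divn_small ?addn0.
exists v; split.
  exists (take e w), (drop e w), x0; split=> //; by rewrite cat_take_drop.
move=> h; apply: nv; apply: kspan_sub h => z [a' a'lt [w' [al' [y0 [we ae va yS zE]]]]].
exists (wval (w' ++ al')).
  rewrite word_value_cat we va.
  apply: (@leq_trans (q ^ e + q ^ e * a')).
    by rewrite ltn_add2r -[X in (_ < q ^ X)%N]we word_value_lt.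
  rewrite -mulnS; apply: (@leq_trans (q ^ e * (n %/ q ^ e))); last by rewrite mulnC leq_trunc_div.
  by rewrite leq_mul2l a'lt orbT.
by exists (w' ++ al'), y0; split=> //; rewrite size_cat we ae subnK.
Qed.

Lemma letter_op_lin c a (z z' : X -> k) :
  letter_op rho beta c (fun x => a * z x + z' x) =
  fun x => rho a * letter_op rho beta c z x + letter_op rho beta c z' x.
Proof.
apply/funext => x; rewrite /letter_op -rmorphM -rmorphD; congr (rho _).
rewrite big_distrr -big_split; apply: eq_bigr => y _ /=.
by rewrite mulrDl mulrA.
Qed.

(** The last letter of a word contributes the top digit.  Its operator is
   semilinear, so it maps a linear dependence on words of smaller value to
   another one. *)
Lemma word_jump_low E n : word_jump E.+1 n -> word_jump E (n %% q ^ E).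
Proof.
move=> [v [[w [x0 [wE wn xS vE]]] nv]].
case/lastP: w wE wn vE => // w c; rewrite size_rcons => -[wE].
rewrite -cats1 word_value_cat /= muln0 addn0 wE => wn vE.
have lt : (wval w < q ^ E)%N by rewrite -wE word_value_lt.
have nE : (n %% q ^ E)%N = wval w by rewrite -wn addnC mulnC modnMDl modn_small.
exists (wop w (unit_vec k x0)); split; first by exists w, x0; rewrite nE.
move=> h; apply: nv; rewrite vE cats1 word_op_rcons => P P0 Pc PA.
apply: (h (fun z => P (letter_op rho beta c z))).
- rewrite (_ : letter_op _ _ _ _ = fun=> 0) //; apply/funext => x.
  by rewrite /letter_op big1 ?rmorph0 // => y _; rewrite mul0r.
- by move=> a z z' Pz Pz'; rewrite letter_op_lin; apply: Pc.
move=> z [n' n'lt [w' [y0 [w'E w'n yS ->]]]].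
apply: PA; exists (wval (rcons w' c)).
  rewrite -cats1 word_value_cat /= muln0 addn0 w'E w'n -wn ltn_add2r.
  by rewrite -nE.
by exists (rcons w' c), y0; split; rewrite ?size_rcons ?w'E // word_op_rcons.
Qed.

End WordJumps.

Section Accumulation.
Variables (RR : realType) (q : nat) (J : nat -> nat -> Prop).
Hypotheses (q1 : (1 < q)%N) (Jlt : forall E n, J E n -> (n < q ^ E)%N)
  (Jlow : forall E n, J E.+1 n -> J E (n %% q ^ E)%N).
Variable K : nat.
Hypothesis JK : forall m, exists sa : seq nat, (size sa <= K)%N /\
  forall E n, (m <= E)%N -> J E n -> (n %/ q ^ (E - m))%N \in sa.

Let Q (m : nat) : RR := (q ^ m)%:R.

(** Accumulation points of the fractions n/q^E with J E n, with a rate of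
   approximation; every M forces levels E >= M, so that the limit is taken
   along the levels. *)
Definition acc (x : RR) : Prop :=
  forall M, exists E n, [/\ (M <= E)%N, J E n & `|x - n%:R / Q E| < (Q M)^-1].

Let Q0 m : 0 < Q m. Proof. by rewrite ltr0n expn_gt0 (ltnW q1). Qed.

Lemma Q_large (d : RR) : 0 < d -> exists m, (Q m)^-1 < d.
Proof.
move=> d0; exists (Num.truncn d^-1).+1; rewrite invf_plt ?posrE //.
apply: lt_trans (truncnS_gt _) _.
by rewrite /Q ltr_nat ltn_expl.
Qed.

Lemma Q_mono m n : (m <= n)%N -> (Q n)^-1 <= (Q m)^-1.
Proof. by move=> mn; rewrite lef_pV2 ?posrE // ler_nat leq_exp2l. Qed.

Lemma acc_near x m : acc x -> exists E n, [/\ (m <= E)%N, J E n &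
  `|x - (n %/ q ^ (E - m))%:R / Q m| < 2 * (Q m)^-1].
Proof.
move=> /(_ m) [E [n [mE JEn lt]]]; exists E, n; split=> //.
have QE : Q E = Q (E - m) * Q m by rewrite /Q -natrM -expnD subnK.
have e : n%:R / Q E - (n %/ q ^ (E - m))%:R / Q m = (n %% q ^ (E - m))%:R / Q E.
  rewrite {1}(divn_eq n (q ^ (E - m))) natrD natrM -/(Q _) mulrDl addrAC QE.
  by rewrite invfM mulrA mulfK ?gt_eqF // subrr add0r mulrA.
rewrite -(subrK (n%:R / Q E) x) -addrA e.
apply: le_lt_trans (ler_normD _ _) _; rewrite [2 * _]mulr_natl mulr2n ltr_leD //.
have r0 a : 0 <= a%:R / Q E by rewrite divr_ge0 // ltW.
rewrite ger0_norm // QE invfM mulrA; apply: ler_piMl; first by rewrite invr_ge0 ltW.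
rewrite ler_pdivrMr // mul1r /Q ler_nat ltnW // ltn_mod expn_gt0 (ltnW q1) //.
Qed.

(** Distinct points are eventually separated by their first m digits, of which
   there are at most K. *)
Lemma acc_card (xs : seq RR) : uniq xs -> (forall x, x \in xs -> acc x) ->
  (size xs <= K)%N.
Proof.
move=> uxs hx.
(* Precision at which the points of xs have distinct truncations. *)
have [m hm] : exists m, forall x y, x \in xs -> y \in xs -> x != y ->
    4 * (Q m)^-1 < `|x - y|.
  have /choice [g gP] : forall xy : RR * RR, exists m, xy.1 != xy.2 ->
      4 * (Q m)^-1 < `|xy.1 - xy.2|.
    move=> [x y] /=; have [->|xy] := eqVneq x y; first by exists 0%N.
    have [|m hm] := @Q_large (`|x - y| / 4); first by rewrite divr_gt0 // normr_gt0 subr_eq0.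
    by exists m => _; rewrite mulrC -ltr_pdivlMr.
  exists (\max_(x <- xs) \max_(y <- xs) g (x, y)) => x y xi yi xy.
  apply: le_lt_trans (gP (x, y) xy); rewrite ler_pM2l // Q_mono //.
  apply: (@leq_trans (\max_(y <- xs) g (x, y))).
    by rewrite (big_rem y) //= leq_maxl.
  by rewrite [X in (_ <= X)%N](big_rem x) //= leq_maxl.
have [sa [saK saP]] := JK m.
have /choice [g gP] : forall x, exists a : nat, x \in xs ->
    a \in sa /\ `|x - a%:R / Q m| < 2 * (Q m)^-1.
  move=> x; have [xi|] := boolP (x \in xs); last by exists 0%N.
  have [E [n [mE JEn lt]]] := acc_near m (hx x xi).
  by exists (n %/ q ^ (E - m))%N => _; split=> //; apply: saP.
apply: leq_trans saK; rewrite -(size_map g); apply: uniq_leq_size.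
  rewrite map_inj_in_uniq // => x y xi yi gxy.
  apply: contrapT => /eqP xy; have := hm x y xi yi xy; apply/negP; rewrite -leNgt.
  have [_ h1] := gP x xi; have [_ h2] := gP y yi; rewrite -gxy in h2.
  rewrite -(subrK ((g x)%:R / Q m) x) -addrA.
  apply: le_trans (ler_normD _ _) _; rewrite (distrC _ y).
  have -> : 4 * (Q m)^-1 = 2 * (Q m)^-1 + 2 * (Q m)^-1 by rewrite -mulrDl -natrD.
  by apply: lerD; exact: ltW.
by move=> _ /mapP[x xi ->]; have [] := gP x xi.
Qed.

(** If n/q^E is near x then (n mod q^(E-1))/q^(E-1) is near q x - r, where r
   is the top digit of n.  Only finitely many r are possible, so one of them
   works for all precisions. *)
Lemma acc_shift x : acc x -> exists r : nat, acc (q%:R * x - r%:R).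
Proof.
move=> hx; apply: contrapT => h.
have /choice [g gP] : forall r : nat, exists M, forall E n, (M <= E)%N -> J E n ->
    (Q M)^-1 <= `|q%:R * x - r%:R - n%:R / Q E|.
  move=> r; apply: contrapT => h'; apply: h; exists r => M.
  apply: contrapT => h2; apply: h'; exists M => E n ME JE.
  by rewrite leNgt; apply/negP => lt; apply: h2; exists E, n.
pose M := \max_(r < q) g r.
have [E0 [n [ME JE lt]]] := hx M.+1; case: E0 ME JE lt => // E ME JE lt.
pose r := (n %/ q ^ E)%N.
have qE0 : (0 < q ^ E)%N by rewrite expn_gt0 (ltnW q1).
have rq : (r < q)%N by rewrite ltn_divLR // -expnS; apply: Jlt.
have gM : (g r <= M)%N by apply: (leq_bigmax (Ordinal rq)).
have := gP r E (n %% q ^ E)%N (leq_trans gM ME) (Jlow JE).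
apply/negP; rewrite -ltNge.
have -> : q%:R * x - r%:R - (n %% q ^ E)%:R / Q E = q%:R * (x - n%:R / Q E.+1).
  rewrite mulrBr -addrA -opprD; congr (_ - _).
  rewrite {2}(divn_eq n (q ^ E)) natrD natrM -/r -/(Q E) /Q expnS natrM invfM -/(Q E).
  rewrite mulrA mulrA [q%:R * _]mulrC mulrK ?unitfE ?pnatr_eq0 -?lt0n ?(ltnW q1) //.
  by rewrite mulrDl mulfK ?gt_eqF.
rewrite normrM ger0_norm // -ltr_pdivlMl ?ltr0n ?(ltnW q1) //.
apply: lt_le_trans lt _; rewrite /Q expnS natrM invfM ler_pM2l ?invr_gt0 ?ltr0n ?(ltnW q1) //.
exact: Q_mono.
Qed.

Lemma acc_bounded x : acc x -> `|x| < 2.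
Proof.
move=> /(_ 0%N) [E [n [_ JE]]]; rewrite {2}/Q invr1 => lt.
rewrite -(subrK (n%:R / Q E) x); apply: le_lt_trans (ler_normD _ _) _.
rewrite (_ : 2 = 1 + 1) // ltr_leD // ger0_norm; last by rewrite divr_ge0 // ltW.
by rewrite ler_pdivrMr // mul1r /Q ler_nat ltnW // Jlt.
Qed.

Lemma acc_finite : finite_set [set x | acc x].
Proof.
apply: contrapT => inf; have [B BA] := @infinite_set_fset _ _ K.+1 inf.
apply/negP; rewrite -ltnNge ltnS; apply: acc_card; first exact: finmap.fset_uniq.
by move=> x xB; exact: BA.
Qed.

(** Iterating x |-> q x - r inside a finite set gives q^i x - s = q^j x - s'
   for some i < j. *)
Lemma acc_rational x : acc x -> @rational RR x.
Proof.
move=> ax; have /choice [g gP] : forall y, exists r : nat, acc y -> acc (q%:R * y - r%:R).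
  move=> y; have [/acc_shift[r hr]|] := pselect (acc y); first by exists r.
  by exists 0%N.
pose xs := fix xs n := if n is m.+1 then q%:R * xs m - (g (xs m))%:R else x.
have axs n : acc (xs n) by elim: n => //= n; apply: gP.
have xsE n : exists s : nat, xs n = (q ^ n)%:R * x - s%:R.
  elim: n => [|n [s sE]]; first by exists 0%N; rewrite mul1r subr0.
  exists (q * s + g (xs n))%N; rewrite /= {1}sE expnS natrM natrD natrM mulrBr mulrA.
  by rewrite opprD addrA.
have : ~~ uniq (mkseq xs K.+1).
  apply/negP => u; have : (size (mkseq xs K.+1) <= K)%N.
    by apply: acc_card u _ => _ /mapP[i _ ->].
  by rewrite size_mkseq ltnn.
move=> /(uniqPn 0) [i [i' [ii']]]; rewrite size_mkseq => i'K.
rewrite !nth_mkseq //; last exact: ltn_trans i'K.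
have [s ->] := xsE i; have [s' ->] := xsE i' => e.
have qq : (q ^ i')%:R - (q ^ i)%:R != 0 :> RR.
  by rewrite subr_eq0 eqr_nat gtn_eqF // ltn_exp2l.
have -> : x = ratr ((s'%:R - s%:R) / ((q ^ i')%:R - (q ^ i)%:R)).
  rewrite fmorph_div !rmorphB /= !ratr_nat; apply: (mulIf qq); rewrite divfK //.
  by rewrite mulrBr ![x * _]mulrC; move: e; lra.
by exists ((s'%:R - s%:R) / ((q ^ i')%:R - (q ^ i)%:R)) => //.
Qed.

End Accumulation.

(** * Submodules, Frobenius powers and flatness *)

Section Submodules.
Variables (R : comNzRingType) (m n : nat).
Local Notation V := 'M[R]_(m, n).
Implicit Types N G : set V.

Lemma submoduleE N : submodule N <->
  N 0 /\ forall (a : R) u v, N u -> N v -> N (a *: u + v).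
Proof.
split=> [[N0 NC]|[N0 NC]]; split.
- by move: N0; rewrite inE.
- by move=> a u v Nu Nv; have := NC a u v; rewrite !inE; apply.
- by rewrite inE.
- by move=> a u v; rewrite !inE; apply: NC.
Qed.

Lemma smallest_submodule G : submodule (smallest (@submodule R m n) G).
Proof.
apply/submoduleE; split=> [N [/submoduleE[N0 _] _] //|a u v hu hv N NG].
have [/submoduleE[_ NC] _] := NG; apply: NC; [exact: hu|exact: hv].
Qed.

Lemma submodule_sum N (T : Type) (r : seq T) (P : pred T) (F : T -> V) :
  submodule N -> (forall i, P i -> N (F i)) -> N (\sum_(i <- r | P i) F i).
Proof.
move=> /submoduleE[N0 NC] h; apply: (big_ind N) => // u v Nu Nv.
by rewrite -[u]scale1r; apply: NC.
Qed.

Lemma submoduleZ N a v : submodule N -> N v -> N (a *: v).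
Proof. by move=> /submoduleE[N0 NC] Nv; rewrite -[_ *: _]addr0; apply: NC. Qed.

Lemma submoduleD N u v : submodule N -> N u -> N v -> N (u + v).
Proof. by move=> /submoduleE[N0 NC] Nu Nv; rewrite -[u]scale1r; apply: NC. Qed.

End Submodules.

Section Brackets.
Variables (R : comNzRingType) (m n : nat).
Local Notation V := 'M[R]_(m, n).
Implicit Types N : set V.

(** The operator psi (a x) on entries; these operators compute Frobenius
   roots, see [bracket_powerP]. *)
Definition twist (psi : R -> R) (a : R) (v : V) : V := map_mx (fun x => psi (a * x)) v.

Lemma bracket_mxD (Q : nat) u v : qth_power_additive R Q ->
  bracket_mx Q (u + v) = bracket_mx Q u + bracket_mx Q v :> V.
Proof. by move=> h; apply/matrixP => i j; rewrite !mxE h. Qed.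

Lemma bracket_mxZ (Q : nat) a v :
  bracket_mx Q (a *: v) = a ^+ Q *: bracket_mx Q v :> V.
Proof. by apply/matrixP => i j; rewrite !mxE exprMn. Qed.

Lemma bracket_powerM (Q Q' : nat) N : (0 < Q')%N -> qth_power_additive R Q' ->
  bracket_power Q' (bracket_power Q N) = bracket_power (Q * Q') N.
Proof.
move=> Q'0 RQ.
have E v : bracket_mx Q' (bracket_mx Q v) = bracket_mx (Q * Q') v :> V.
  by apply/matrixP => i j; rewrite !mxE exprM.
apply/seteqP; split=> v hv M [hM MG]; apply: hv; split=> // _ [u hu <-].
  apply: (hu [set u | M (bracket_mx Q' u)]); split.
    apply/submoduleE; split=> [|a x y /= Mx My].
      rewrite /=; suff -> : bracket_mx Q' (0 : V) = 0 by case/submoduleE: hM.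
      by apply/matrixP => i j; rewrite !mxE expr0n eqn0Ngt Q'0.
    rewrite bracket_mxD // bracket_mxZ; have /submoduleE[_ MC] := hM; exact: MC.
  by move=> _ [w Nw <-] /=; rewrite E; apply: MG; exists w.
by rewrite -E; apply: MG; exists (bracket_mx Q u) => //; move=> P [_]; apply; exists u.
Qed.

Section Dual.
Variables (Q : nat) (T : finType) (b : T -> R) (phi : T -> R -> R).
Hypotheses (phiP : forall t, inv_frob_linear Q (phi t))
  (phiE : forall x, x = \sum_t phi t x ^+ Q * b t).

(** The dual basis writes v = sum_t phi_t(v)^{[Q]} b_t, which settles one
   direction; the other one holds for every q^-1-linear operator. *)
Lemma bracket_powerP N v : submodule N ->
  bracket_power Q N v <-> forall t a, N (twist (phi t) a v).
Proof.
move=> hN; split=> [hv t|h].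
  apply: (hv [set v | forall a, N (twist (phi t) a v)]); split.
    apply/submoduleE; split=> [a|c x y hx hy a] /=.
      suff -> : twist (phi t) a 0 = 0 by case/submoduleE: hN.
      by apply/matrixP => i j; rewrite !mxE mulr0 (inv_frob0 (phiP t)).
    have -> : twist (phi t) a (c *: x + y) = twist (phi t) (a * c) x + twist (phi t) a y.
      by apply/matrixP => i j; rewrite !mxE mulrDr (phiP t).1 mulrA.
    exact: submoduleD.
  move=> _ [w Nw <-] a /=.
  have -> : twist (phi t) a (bracket_mx Q w) = phi t a *: w.
    by apply/matrixP => i j; rewrite !mxE mulrC (phiP t).2 mulrC.
  exact: submoduleZ.
have -> : v = \sum_t b t *: bracket_mx Q (twist (phi t) 1 v).
  apply/matrixP => i j; rewrite summxE [LHS]phiE; apply: eq_bigr => t _.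
  by rewrite !mxE mul1r mulrC.
have sB : submodule (bracket_power Q N) by exact: smallest_submodule.
apply: submodule_sum => // t _; apply: (submoduleZ _ sB) => P [_]; apply.
by exists (twist (phi t) 1 v).
Qed.

(** Finitely many multipliers suffice because the b t' generate R over its
   Q-th powers. *)
Lemma bracket_powerPb N v : submodule N ->
  bracket_power Q N v <-> forall t t', N (twist (phi t) (b t') v).
Proof.
move=> hN; rewrite bracket_powerP //; split=> [h t t'|h t a]; first exact: h.
have -> : twist (phi t) a v = \sum_t' phi t' a *: twist (phi t) (b t') v.
  apply/matrixP => i j; rewrite summxE !mxE [in LHS](phiE a) mulr_suml (inv_frob_sum (phiP t)).
  by apply: eq_bigr => t' _; rewrite !mxE -mulrA (phiP t).2.
by apply: submodule_sum => // t' _; apply: submoduleZ.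
Qed.

End Dual.
End Brackets.

Section LinOp.
Variables (R : comNzRingType) (m n : nat).
Local Notation V := 'M[R]_(m, n).
Local Notation coeffs := ('I_m -> 'I_n -> 'I_m -> 'I_n -> R).

Definition lin_op (a : coeffs) (y : V) : V :=
  \matrix_(i, j) \sum_u \sum_v a i j u v * y u v.

Definition coeff_power (Q : nat) (a : coeffs) : coeffs := fun i j u v => a i j u v ^+ Q.

Lemma lin_opP a c x y : lin_op a (c *: x + y) = c *: lin_op a x + lin_op a y.
Proof.
apply/matrixP => i j; rewrite !mxE big_distrr -big_split; apply: eq_bigr => u _ /=.
rewrite big_distrr -big_split; apply: eq_bigr => v _ /=.
by rewrite !mxE mulrDr mulrCA.
Qed.

Lemma lin_op0 a : lin_op a 0 = 0.
Proof.
by apply/matrixP => i j; rewrite !mxE big1 // => u _; rewrite big1 // => v _; rewrite mxE mulr0.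
Qed.

Lemma twist_lin_op Q psi c a x : inv_frob_linear Q psi ->
  twist psi c (lin_op (coeff_power Q a) x) = lin_op a (twist psi c x).
Proof.
move=> hpsi; apply/matrixP => i j; rewrite !mxE big_distrr (inv_frob_sum hpsi).
apply: eq_bigr => u _ /=; rewrite big_distrr (inv_frob_sum hpsi).
by apply: eq_bigr => v _ /=; rewrite mxE mulrCA hpsi.2.
Qed.

Lemma submodule_preim a N : submodule N -> submodule [set y | N (lin_op a y)].
Proof.
move=> /submoduleE[N0 NC]; apply/submoduleE; split=> [|c x y] /=.
  by rewrite lin_op0.
by rewrite lin_opP; apply: NC.
Qed.

(** Flatness of the Frobenius: taking Frobenius powers commutes with taking
   inverse images under linear maps. *)
Lemma bracket_power_preim Q a N v : frob_dual_basis R Q -> submodule N ->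
  bracket_power Q N (lin_op (coeff_power Q a) v) <->
  bracket_power Q [set y | N (lin_op a y)] v.
Proof.
move=> [T [b [phi [phiP phiE]]]] hN.
rewrite !(bracket_powerP phiP phiE) //; last exact: submodule_preim.
by split=> h t c; have := h t c; rewrite /= (twist_lin_op _ _ _ (phiP t)).
Qed.

End LinOp.

(** * List modules as spans of words *)

(** The power h^Q involves only powers of the variable that are multiples of
   Q, so the low digit n of the exponent comes from g. *)
Lemma coef_power_mul (R : comNzRingType) (Q : nat) (h g : {poly R}) n m :
  (0 < Q)%N -> (n < Q)%N -> qth_power_additive {poly R} Q ->
  (h ^+ Q * g)`_(m * Q + n) = \sum_(v < m.+1) h`_(m - v) ^+ Q * g`_(v * Q + n).
Proof.
move=> Q0 nQ PQ.
have -> : h ^+ Q * g = \sum_(y < size h) (h`_y ^+ Q) *: ('X^(y * Q) * g).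
  rewrite -{1}[h]coefK poly_def (qth_power_sum Q0 PQ) big_distrl /=.
  by apply: eq_bigr => y _; rewrite exprZn -exprM scalerAl.
(* The index y counts the powers of X^Q taken from h; then m - y remain for g.
   *)
pose G y := if (y <= m)%N then h`_y ^+ Q * g`_((m - y) * Q + n) else 0.
have G0 y : (size h <= y)%N -> G y = 0.
  by move=> hy; rewrite /G nth_default // expr0n eqn0Ngt Q0 mul0r if_same.
transitivity (\sum_(y < size h) G y).
  rewrite coef_sum; apply: eq_bigr => y _; rewrite coefZ coefXnM /G.
  have -> : (m * Q + n < y * Q)%N = ~~ (y <= m)%N.
    rewrite -ltnNge; apply/idP/idP => h1.
      rewrite -(ltn_pmul2r Q0); exact: leq_ltn_trans (leq_addr _ _) h1.
    have : (m.+1 * Q <= y * Q)%N by rewrite leq_mul2r h1 orbT.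
    by apply: leq_trans; rewrite mulSn addnC ltn_add2r.
  case: leqP => ym /=; last by rewrite mulr0.
  congr (_ * _); congr (g`_ _); rewrite mulnBl addnBAC // leq_mul2r ym orbT //.
have W a c : (a <= c)%N -> (forall y, (a <= y)%N -> G y = 0) ->
    \sum_(y < a) G y = \sum_(y < c) G y.
  move=> ac h0; rewrite (big_ord_widen c (fun y => G y) ac) big_mkcond.
  by apply: eq_bigr => y _; case: ltnP => // /h0 ->.
rewrite (W (size h) (size h + m.+1)%N) ?leq_addr // -(W m.+1) ?leq_addl //; last first.
  by move=> y my; rewrite /G leqNgt my.
rewrite (reindex_inj rev_ord_inj); apply: eq_bigr => v _ /=.
by rewrite /G subSS leq_subr subKn // -ltnS.
Qed.

Section ListWords.
Variables (R : comNzRingType) (p f l : nat).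
Local Notation q := (p ^ f)%N.
Variable A : nat -> 'I_q -> 'M[R]_l.
Hypotheses (f0 : (0 < f)%N) (cR : p \in [pchar R]).
Variables (T : finType) (b : T -> R) (phi : T -> R -> R).
Hypotheses (phiP : forall t, inv_frob_linear q (phi t))
  (phiE : forall x, x = \sum_t phi t x ^+ q * b t).
Hypothesis dualE : forall E, frob_dual_basis R (q ^ E).
Local Notation N := (list_degree A).
Local Notation V := 'M[R]_(l, N.+1).

Let q1 : (1 < q)%N. Proof. by rewrite -(exp1n f) ltn_exp2r // prime_gt1 // (pcharf_prime cR). Qed.
Let q0 : (0 < q)%N. Proof. exact: ltnW. Qed.

(** The matrix of L_r, truncated to degree at most N in tau: L_r multiplies by
   A(t) and keeps the coefficients of t^(q j + r) as those of tau^j.  The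
   truncation is harmless because every H^e_n has degree at most N. *)
Definition shift_coeffs (r : nat) : 'I_l -> 'I_N.+1 -> 'I_l -> 'I_N.+1 -> R :=
  fun i j u v => if (v <= q * j + r)%N then (list_mx A i u)`_(q * j + r - v) else 0.

(** A letter consists of a digit r and of two indices t', t; it acts by the
   q^-1-linear operator y |-> phi_t (b_t' L_r y). *)
Definition list_letter : finType := ('I_q * T * T)%type.
Definition letter_digit (c : list_letter) : nat := c.1.1.

Definition list_op (c : list_letter) (y : V) : V :=
  twist (phi c.2) (b c.1.2) (lin_op (shift_coeffs (letter_digit c)) y).

Definition list_word (w : seq list_letter) (y : V) : V := foldl (fun z c => list_op c z) y w.

Local Notation wval := (word_value q letter_digit).

(** The coefficients of the u-th column of H^E_n, computed along the digits of
   n; see [list_vecE]. *)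
Fixpoint list_vec (E n : nat) (u : 'I_l) : V :=
  if E is E'.+1 then
    lin_op (coeff_power (q ^ E') (shift_coeffs (n %/ q ^ E'))) (list_vec E' (n %% q ^ E') u)
  else delta_mx u ord0.

(** Compare coefficients in A(t)^{E+1} = A(t)^{[q^{E+1}]} A(t)^E, where
   [coef_power_mul] splits the exponent of t into its top digit and the rest.
   *)
Lemma list_vecE E n u i j : (n < q ^ E.+1)%N ->
  list_vec E.+1 n u i j = (list_poly A E.+1 n i u)`_j.
Proof.
rewrite list_poly_coef // succnK.
elim: E n u i j => [|E IH] n u i j nlt.
  rewrite /= mxE /coeff_power (bigD1 u) //= (bigD1 ord0) //= mxE !eqxx mulr1.
  rewrite [X in _ + X + _]big1 ?[X in _ + X]big1 ?addr0; last 2 first.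
  - by move=> u' /negPf hu; rewrite big1 // => v _; rewrite mxE hu mulr0.
  - by move=> v /negPf hv; rewrite mxE hv andbF mulr0.
  by rewrite /shift_coeffs !divn1 subn0 expr1 mulnC expn1.
set Q := (q ^ E.+1)%N; set r := (n %/ Q)%N; set c := (n %% Q)%N.
have Q0 : (0 < Q)%N by rewrite expn_gt0 q0.
have cQ : (c < Q)%N by rewrite ltn_mod.
rewrite -[list_vec E.+2 n u]/(lin_op (coeff_power Q (shift_coeffs r)) (list_vec E.+1 c u)).
rewrite /= [RHS](_ : _ = ((bracket_mx Q (list_mx A) *m list_pow A E) i u)`_((q * j + r) * Q + c)); last first.
  congr (_ `_ _); rewrite -/Q expnS -/Q mulnDl -addnA -(divn_eq n Q).
  by rewrite mulnA [(j * q)%N]mulnC.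
rewrite !mxE coef_sum; apply: eq_bigr => u' _; rewrite mxE coef_power_mul //; last first.
  rewrite /Q -expnM; apply: pchar_qadd; by rewrite pchar_poly.
set m := (q * j + r)%N.
(* The two sums have the same support: terms with v > m are zero by
   definition, and those with v > N vanish because H^(E+1)_c has degree at
   most N. *)
pose G v := if (v <= m)%N then (list_mx A i u')`_(m - v) ^+ Q * (list_pow A E u' u)`_(v * Q + c) else 0.
transitivity (\sum_(v < N.+1) G v).
  apply: eq_bigr => v _; rewrite IH // /coeff_power /shift_coeffs -/m /G.
  by case: ifP => // _; rewrite expr0n eqn0Ngt Q0 mul0r.
transitivity (\sum_(v < m.+1) G v); last first.
  by apply: eq_bigr => v _; rewrite /G -ltnS ltn_ord.
have W a d : (a <= d)%N -> (forall y, (a <= y)%N -> G y = 0) ->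
    \sum_(y < a) G y = \sum_(y < d) G y.
  move=> ad h0; rewrite (big_ord_widen d (fun y => G y) ad) big_mkcond.
  by apply: eq_bigr => y _; case: ltnP => // /h0 ->.
rewrite (W N.+1 (N.+1 + m.+1)%N) ?leq_addr // -?(W m.+1) ?leq_addl //.
  by move=> y my; rewrite /G leqNgt my.
move=> y Ny; rewrite /G; case: ifP => // _.
have := list_poly_coef A E.+1 c u' u y q1; rewrite succnK -/Q => <-.
have [Nb _] := list_degreeP A q1.
by rewrite [X in _ * X]nth_default ?mulr0 //; apply: leq_trans (Nb _ _ _ _ _ _) Ny.
Qed.

Lemma list_word_rcons w c y : list_word (rcons w c) y = list_op c (list_word w y).
Proof. by rewrite /list_word -cats1 foldl_cat. Qed.

Lemma wval_rcons w c : wval (rcons w c) = (wval w + q ^ size w * letter_digit c)%N.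
Proof. by rewrite -cats1 word_value_cat /= muln0 addn0. Qed.

Let wlt w : (wval w < q ^ size w)%N.
Proof. by apply: word_value_lt => // c; apply: ltn_ord. Qed.

Lemma bracket_power1 (P : set V) v : submodule P -> bracket_power 1 P v <-> P v.
Proof.
have E (w : V) : bracket_mx 1 w = w by apply/matrixP => i j; rewrite !mxE expr1.
move=> hP; split=> [h|Pv M [_ MG]].
  by apply: h; split=> // _ [w Pw <-]; rewrite E.
by apply: MG; exists v.
Qed.

(** In the induction the dual basis turns the last letter, required to send y
   into P, into the condition L_r y in P^{[q]}; by flatness the preimage of
   P^{[q]} under L_r can then take the place of P.  As P varies the condition
   determines the Frobenius root of the image of H^E_n. *)
Lemma list_words_bracket E n (P : set V) : (n < q ^ E)%N -> submodule P ->
  (forall w u, size w = E -> wval w = n -> P (list_word w (delta_mx u ord0))) <->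
  (forall u, bracket_power (q ^ E) P (list_vec E n u)).
Proof.
elim: E n P => [|E IH] n P nlt hP.
  rewrite expn0; move: nlt; rewrite expn0 ltnS leqn0 => /eqP ->.
  split=> [h u|h w u /size0nil -> _]; first by apply/bracket_power1 => //; apply: (h [::]).
  by apply/(bracket_power1 _ hP); apply: h.
set r := (n %/ q ^ E)%N; set c := (n %% q ^ E)%N.
have QE0 : (0 < q ^ E)%N by rewrite expn_gt0 q0.
have rq : (r < q)%N by rewrite ltn_divLR // -expnS.
have cQ : (c < q ^ E)%N by rewrite ltn_mod.
have sB : submodule (bracket_power q P) by exact: smallest_submodule.
have RQ : qth_power_additive R (q ^ E) by rewrite -expnM; apply: pchar_qadd.
have -> : (forall u, bracket_power (q ^ E.+1) P (list_vec E.+1 n u)) <->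
    (forall u, bracket_power (q ^ E) [set y | bracket_power q P (lin_op (shift_coeffs r) y)]
       (list_vec E c u)).
  by split=> h u; have := h u; rewrite /= expnS -(bracket_powerM q P QE0 RQ)
    -/r -/c (bracket_power_preim _ _ (dualE E)).
rewrite -(IH c) //; last exact: submodule_preim.
split=> [h w u wE wn|h w u].
  apply/(bracket_powerPb phiP phiE) => // t t'.
  have := h (rcons w (Ordinal rq, t', t)) u; rewrite list_word_rcons; apply.
    by rewrite size_rcons wE.
  by rewrite wval_rcons wE wn /= /letter_digit /= addnC mulnC -divn_eq.
case/lastP: w => // w [[d t'] t]; rewrite size_rcons => -[wE].
rewrite wval_rcons wE => wn.
have wc : wval w = c by rewrite /c -wn addnC mulnC modnMDl modn_small // -wE wlt.
have dr : r = d by rewrite /r -wn addnC mulnC divnMDl // divn_small ?addn0 // -wE wlt.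
have /(bracket_powerPb phiP phiE) := h w u wE wc => /(_ hP t t').
by rewrite list_word_rcons /list_op /letter_digit /= dr.
Qed.

Definition word_vecs (E n : nat) : set V :=
  [set y | exists w u, [/\ size w = E, wval w = n & y = list_word w (delta_mx u ord0)]].

(** Both sides are intersections of the same family of submodules, by
   [list_words_bracket]. *)
Lemma list_root_words E n : (n < q ^ E.+1)%N ->
  bracket_root (q ^ E.+1) (@list_image R l N (list_poly A E.+1 n)) =
  smallest (@submodule R l N.+1) (word_vecs E.+1 n).
Proof.
move=> nlt.
have main P : submodule P ->
   (@list_image R l N (list_poly A E.+1 n) `<=` bracket_power (q ^ E.+1) P) <->
   (word_vecs E.+1 n `<=` P).
  move=> hP; have sB : submodule (bracket_power (q ^ E.+1) P) by exact: smallest_submodule.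
  transitivity (forall u, bracket_power (q ^ E.+1) P (list_vec E.+1 n u)).
    split=> [h u|h _ [v _ <-]].
      apply: h; exists (delta_mx u ord0) => //; apply/matrixP => i j.
      rewrite list_vecE // !mxE coef_sum (bigD1 u) //= big1 ?addr0.
        by rewrite !mxE !eqxx coefMC mulr1.
      by move=> u' /negPf hu; rewrite !mxE hu mulr0 coef0.
    have -> : \matrix_(i, j) ((list_poly A E.+1 n *m map_mx polyC v) i 0)`_j =
        \sum_u v u 0 *: list_vec E.+1 n u :> V.
      apply/matrixP => i j; rewrite summxE mxE [in LHS]mxE coef_sum; apply: eq_bigr => u _.
      by rewrite [RHS]mxE list_vecE // [map_mx polyC v u 0]mxE coefMC mulrC.
    by apply: submodule_sum => // u _; exact: (submoduleZ _ sB (h u)).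
  rewrite -(list_words_bracket nlt hP); split=> [h _ [w [u [wE wn ->]]]|h w u wE wn].
    exact: h.
  by apply: h; exists w, u.
apply/seteqP; split=> y hy P [hP PG]; apply: hy; split=> //; exact/main.
Qed.

End ListWords.

(** * Jumps of list test modules and jumping numbers *)

Section ListJumps.
Variables (RR : realType) (R : comNzRingType) (p f l : nat).
Local Notation q := (p ^ f)%N.
Variable A : nat -> 'I_q -> 'M[R]_l.
Hypotheses (f0 : (0 < f)%N) (cR : p \in [pchar R]).
Variables (T : finType) (b : T -> R) (phi : T -> R -> R).
Hypotheses (phiP : forall t, inv_frob_linear q (phi t))
  (phiE : forall x, x = \sum_t phi t x ^+ q * b t).
Hypothesis dualE : forall E, frob_dual_basis R (q ^ E).
Local Notation N := (list_degree A).
Local Notation V := 'M[R]_(l, N.+1).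
Local Notation word_vecs := (@word_vecs R p f l A T b phi).

Definition module_jump (E n : nat) : Prop :=
  exists y, word_vecs E n y /\
    ~ smallest (@submodule R l N.+1) (\bigcup_(n' in [set n' | (n' < n)%N]) word_vecs E n') y.

(** The module attached to mu only depends on the integer n with n < mu
   q^(e+1) <= n + 1, so the test module is constant between consecutive
   multiples of q^-(e+1). *)
Lemma list_jump_module (lambda : RR) e : list_jumps A e lambda ->
  exists n, module_jump e.+1 n /\ lambda = n%:R / (q ^ e.+1)%:R.
Proof.
move=> [/andP[l0 l1] jmp].
have p1 : (1 < p)%N by exact/prime_gt1/(pcharf_prime cR).
set Q := (q ^ e.+1)%N.
have Qn0 : (0 < Q)%N by rewrite !expn_gt0 (ltnW p1).
have Q0 : 0 < Q%:R :> RR by rewrite ltr0n.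
pose c (mu : RR) := (`|Num.ceil (mu * Q%:R)|%N.-1)%N.
have cP (mu : RR) : 0 < mu -> (c mu)%:R < mu * Q%:R /\ mu * Q%:R <= (c mu).+1%:R.
  move=> mu0; have y0 : 0 < Num.ceil (mu * Q%:R) by rewrite ceil_gt0 mulr_gt0.
  have := ceil_itv (mu * Q%:R); rewrite /c.
  case: (Num.ceil _) y0 => // -[//|a] _ /= /andP[h1 h2].
  by split=> //; move: h1; rewrite -addn1 PoszD addrK.
have cE (mu : RR) n : 0 < mu -> n%:R < mu * Q%:R -> mu * Q%:R <= n.+1%:R -> c mu = n.
  move=> mu0 h1 h2; have [h3 h4] := cP mu mu0.
  have := lt_le_trans h1 h4; have := lt_le_trans h3 h2; rewrite !ltr_nat !ltnS => h5 h6.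
  by apply/eqP; rewrite eqn_leq h5 h6.
have clt (mu : RR) : 0 < mu -> mu <= 1 -> (c mu < Q)%N.
  move=> mu0 mu1; have [h3 _] := cP mu mu0.
  by rewrite -(ltr_nat RR); apply: lt_le_trans h3 _; rewrite ler_piMl // ltW.
pose tst (mu : RR) : set V := list_test_module mu e.
have tsub (mu : RR) : submodule (tst mu) by exact: smallest_submodule.
have tin (mu nu : RR) : 0 < mu -> mu <= 1 -> mu <= nu -> word_vecs e.+1 (c mu) `<=` tst nu.
  move=> mu0 mu1 munu y hy P [hP PG]; apply: PG; exists mu; first by rewrite /= mu0 munu.
  rewrite -/Q -/(c mu) (list_root_words A f0 cR phiP phiE dualE (clt mu mu0 mu1)).
  by move=> P' [_]; apply.
pose n := Num.truncn (lambda * Q%:R).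
have y0 : 0 <= lambda * Q%:R by rewrite ltW // mulr_gt0.
have /andP[n1 n2] := truncn_itv y0; rewrite -/n in n1 n2.
have nQ : (n < Q)%N.
  by rewrite -(ltr_nat RR); apply: le_lt_trans n1 _; rewrite gtr_pMl.
(* The next multiple of 1/Q; between lambda and lambda' the index takes the
   value n only. *)
pose lambda' : RR := n.+1%:R / Q%:R.
have ll' : lambda < lambda' by rewrite ltr_pdivlMr.
have l'1 : lambda' <= 1 by rewrite ler_pdivrMr // mul1r ler_nat.
have [y [yn ny]] : exists y, word_vecs e.+1 n y /\ ~ tst lambda y.
  apply: contrapT => h; apply: (jmp lambda'); first by rewrite ll' l'1.
  apply/seteqP; split=> v hv P [hP PG]; apply: hv; split=> //; last first.
    move=> u [mu /andP[mu0 mul] hu]; apply: PG; exists mu => //=.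
    by rewrite mu0 (le_trans mul) // ltW.
  suff : \bigcup_(mu in [set mu : RR | 0 < mu <= lambda'])
     bracket_root Q (list_image (list_poly A e.+1 (c mu))) `<=` tst lambda.
    by move=> tt u hu; apply: (tt u hu).
  move=> u [mu /andP[mu0 mul] hu].
  have mu1 : mu <= 1 by exact: le_trans l'1.
  rewrite (list_root_words A f0 cR phiP phiE dualE (clt mu mu0 mu1)) in hu.
  apply: hu; split=> // z hz.
  have [ml|lm] := leP mu lambda; first exact: tin hz.
  have cn : c mu = n.
    apply: cE => //; first by apply: le_lt_trans n1 _; rewrite ltr_pM2r.
    by rewrite -ler_pdivlMr.
  by apply: contrapT => nz; apply: h; exists z; rewrite -cn.
(* Otherwise the index of lambda itself is n, and y would lie in the test
   module at lambda. *)
have ln : lambda * Q%:R = n%:R.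
  apply/eqP; rewrite eq_le n1 andbT leNgt; apply/negP => lt.
  apply: ny; apply: (tin lambda lambda) => //; first exact: ltW.
  by rewrite (cE lambda n) // ltW.
exists n; split; last by rewrite -ln mulfK // gt_eqF.
exists y; split=> // h; apply: ny; apply: h; split=> // z [n' /= n'n hz].
have n'0 : 0 < n'.+1%:R / Q%:R :> RR by rewrite divr_gt0.
apply: (tin (n'.+1%:R / Q%:R)) => //.
- by rewrite ler_pdivrMr // mul1r ler_nat (leq_trans n'n) // ltnW.
- by rewrite ler_pdivrMr // ln ler_nat.
by rewrite (cE _ n') // divfK ?gt_eqF // ltr_nat.
Qed.

End ListJumps.

Section LiftJumps.
Variables (k : fieldType) (R : comNzRingType) (iota : {rmorphism k -> R}) (p f l : nat).
Local Notation q := (p ^ f)%N.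
Variable A : nat -> 'I_q -> 'M[R]_l.
Hypotheses (f0 : (0 < f)%N) (cR : p \in [pchar R]).
Variables (T : finType) (b : T -> R) (phi : T -> R -> R).
Hypotheses (phiP : forall t, inv_frob_linear q (phi t)).
Variables (I : finType) (s : I -> R).
Hypothesis hs : presented (iota) s.
Variable rho : {rmorphism k -> k}.
Hypothesis rhoE : forall x, rho x ^+ q = x.
Local Notation N := (list_degree A).
Local Notation V := 'M[R]_(l, N.+1).
Local Notation letter := (list_letter p f T).

(** Contraction produces finitely many elements w_h of R such that the
   k-combinations of matrices with entries w_h are stable under all letters.
   The map theta from coordinates to such matrices intertwines a semilinear
   system over k with the letters, and a k-linear dependence is mapped to an
   R-linear one. *)
Lemma module_jump_word : exists (X : finType) (beta : letter -> X -> X -> k) (S0 : {set X}),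
  forall E n, module_jump A b phi E n ->
    word_jump rho q beta S0 (@letter_digit p f T) E n.
Proof.
have q1 : (1 < q)%N by rewrite -(exp1n f) ltn_exp2r // prime_gt1 // (pcharf_prime cR).
pose C : finType := (letter * 'I_l * 'I_N.+1 * 'I_l * 'I_N.+1)%type.
pose psi (c : C) (x : R) := phi c.1.1.1.1.2 (b c.1.1.1.1.1.2 *
  (@shift_coeffs R p f l A (letter_digit c.1.1.1.1) c.1.1.1.2 c.1.1.2 c.1.2 c.2 * x)).
have psiP c : inv_frob_linear q (psi c).
  split=> [x y|r x]; first by rewrite /psi !mulrDr (phiP _).1.
  by rewrite /psi -(phiP _).2; congr (phi _ _); rewrite [RHS]mulrCA; congr (_ * _); exact: mulrCA.
have kq (x : k) : exists y, y ^+ q = x by exists (rho x).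
have [H [w [h1 [wh1 hkap]]]] := contraction q1 (pchar_qadd f cR) kq hs psiP.
have /choice [kap kapE] : forall ch : C * H, exists kap : H -> k,
  psi ch.1 (w ch.2) = \sum_h' iota (kap h') * w h' by case=> c h; apply: hkap.
pose X : finType := ('I_l * 'I_N.+1 * H)%type.
pose beta (c : letter) (y x : X) : k :=
  kap ((c, x.1.1, x.1.2, y.1.1, y.1.2), y.2) x.2 ^+ q.
pose S0 : {set X} := finset (fun x : X => (x.1.2 == ord0) && (x.2 == h1)).
pose theta (z : X -> k) : V := \matrix_(u, v) \sum_h iota (z (u, v, h)) * w h.
have rX x : rho (x ^+ q) = x by rewrite rmorphXn rhoE.
have thetaE c z : theta (letter_op rho beta c z) = @list_op R p f l A T b phi c (theta z).
  apply/matrixP => i j; rewrite !mxE.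
  rewrite big_distrr (inv_frob_sum (phiP _)) /=.
  under [RHS]eq_bigr => u _ do rewrite big_distrr (inv_frob_sum (phiP _)) /=.
  have E u v : phi c.2 (b c.1.2 * (@shift_coeffs R p f l A (letter_digit c) i j u v * theta z u v)) =
      \sum_h \sum_h' iota (rho (z (u, v, h)) * kap ((c, i, j, u, v), h) h') * w h'.
    rewrite mxE !big_distrr (inv_frob_sum (phiP _)); apply: eq_bigr => h _ /=.
    have -> : b c.1.2 * (@shift_coeffs R p f l A (letter_digit c) i j u v * (iota (z (u, v, h)) * w h))
      = (iota (rho (z (u, v, h)))) ^+ q * (b c.1.2 * (@shift_coeffs R p f l A (letter_digit c) i j u v * w h)).
      rewrite -rmorphXn rhoE /= [in RHS]mulrCA; congr (_ * _); exact: mulrCA.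
    rewrite (phiP _).2 -[phi _ _]/(psi (c, i, j, u, v) (w h)) (kapE ((c, i, j, u, v), h)).
    by rewrite big_distrr; apply: eq_bigr => h' _ /=; rewrite [in RHS]rmorphM mulrA.
  under [RHS]eq_bigr => u _ do under eq_bigr => v _ do rewrite E.
  transitivity (\sum_h' \sum_(y : X)
      iota (rho (z y) * kap ((c, i, j, y.1.1, y.1.2), y.2) h') * w h').
    apply: eq_bigr => h' _; rewrite /letter_op rmorph_sum rmorph_sum /= mulr_suml.
    by apply: eq_bigr => y _; rewrite rmorphM rX.
  rewrite exchange_big /= [RHS]pair_bigA [RHS]pair_bigA /=.
  by apply: eq_bigr => -[[u v] h] _.
have theta_word w0 z : theta (word_op rho beta w0 z) = @list_word R p f l A T b phi w0 (theta z).
  by elim: w0 z => //= c w0 IH z; rewrite IH thetaE.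
have theta_unit u : theta (unit_vec k (u, ord0, h1)) = delta_mx u ord0.
  apply/matrixP => i j; rewrite !mxE (bigD1 h1) //= big1 ?addr0.
    rewrite wh1 mulr1 /unit_vec /=; rewrite -[(_, _) == _]/((_ && _) && _).
    by rewrite eqxx andbT rmorph_nat.
  move=> h /negPf hh; rewrite /unit_vec -[(_, _) == _]/((_ && _) && _) hh andbF.
  by rewrite rmorph0 mul0r.
have theta_lin c z z' : theta (fun x => c * z x + z' x) = iota c *: theta z + theta z'.
  apply/matrixP => i j; rewrite !mxE big_distrr -big_split; apply: eq_bigr => h _ /=.
  by rewrite rmorphD rmorphM mulrDl mulrA.
have theta0 : theta (fun=> 0) = 0.
  by apply/matrixP => i j; rewrite !mxE big1 // => h _; rewrite rmorph0 mul0r.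
exists X, beta, S0 => E n [y [[w0 [u [wE wn yE]]] ny]].
exists (word_op rho beta w0 (unit_vec k (u, ord0, h1))); split.
  by exists w0, (u, ord0, h1); split; rewrite // inE /= !eqxx.
move=> hsp; apply: ny => P [hP PG].
have := hsp (fun z => P (theta z)).
rewrite theta_word theta_unit yE; apply.
- by rewrite theta0; case/submoduleE: hP.
- by move=> c z z' Pz Pz'; rewrite theta_lin; have /submoduleE[_ PC] := hP; exact: PC.
move=> z [n' n'n [w1 [[[u1 v1] g1] [w1E w1n]]]].
rewrite inE /= => /andP[/eqP -> /eqP ->] ->.
by rewrite theta_word theta_unit; apply: PG; exists n' => //; exists w1, u1.
Qed.

End LiftJumps.

Section Discrete.
Variable RR : realType.

Lemma finite_near_discrete (J : set RR) :
  (forall t : RR, finite_set (J `&` [set x | `|t - x| < 1])) -> discrete_subset J.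
Proof.
move=> fin; apply/seteqP; split=> // t lt; exfalso.
have : closed ((J `&` [set x | `|t - x| < 1]) `\ t).
  apply: (iffLR accessible_finite_set_closed); last exact: finite_setD.
  exact: hausdorff_accessible (@Rhausdorff RR).
move=> cl.
have nb : nbhs t (ball t 1 `&` ~` ((J `&` [set x | `|t - x| < 1]) `\ t)).
  apply: filterI; first exact: nbhsx_ballx.
  by apply: open_nbhs_nbhs; split; [exact: closed_openC|move=> [_]; apply].
have [y [yt Jy [yb ny]]] := lt _ nb.
by apply: ny; split; [split|apply/eqP].
Qed.
End Discrete.

Theorem theorem3p24 (RR : realType) (k : fieldType) (p f q : nat)
    (R : comAlgType k) (l : nat) (A : nat -> 'I_q -> 'M[R]_l)
    (hk : perfect_of_char k p)
    (hf : (0 < f)%N) (hq : q = (p ^ f)%N)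
    (hR : smooth_eft R)
    (hA : finite_set [set kn : nat * 'I_q | A kn.1 kn.2 <> 0]) :
  [/\ discrete_subset (jumping_numbers A RR),
      jumping_numbers A RR `<=` @rational RR,
      discrete_subset (extended_jumping_numbers A RR)
    & extended_jumping_numbers A RR `<=` @rational RR].
Proof.
subst q; have [ck kp] := hk; have [hE smooth] := hR.
have [I [s hs]] := essentially_finite_presented hE.
have cR : p \in [pchar R] by exact: (rmorph_pchar (in_alg R)).
have p1 : (1 < p)%N by exact/prime_gt1/(pcharf_prime ck).
have q1 : (1 < p ^ f)%N by rewrite -(exp1n f) ltn_exp2r.
have q0 : (0 < p ^ f)%N by exact: ltnW.
have dualE E : frob_dual_basis R ((p ^ f) ^ E).
  case: E => [|E]; last by rewrite -expnM; apply: smooth_dual_basis hk _ smooth hs; rewrite muln_gt0 hf.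
  exists unit, (fun=> 1), (fun=> id); split=> [_|x]; first by split=> // r x; rewrite expr1.
  by rewrite big_const card_unit /= expr1 mulr1 addr0.
have [T [b [phi [phiP phiE]]]] := smooth_dual_basis hk hf smooth hs.
have kq := perfect_qth_root f kp.
have [rho rhoE] := qth_root_exists q0 (pchar_qadd f ck) kq.
have [X [beta [S0 jw]]] := module_jump_word A hf cR b phiP hs rhoE.
have [K JK] := jumps_bounded beta S0 (@letter_digit p f T) hf ck rhoE.
pose J := word_jump rho (p ^ f) beta S0 (@letter_digit p f T).
have dgq (c : list_letter p f T) : (letter_digit c < p ^ f)%N by exact: ltn_ord.
have Jlt E n : J E n -> (n < (p ^ f) ^ E)%N by apply: word_jump_lt.
have Jlow E n : J E.+1 n -> J E (n %% (p ^ f) ^ E)%N by apply: word_jump_low.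
have JK' m : exists sa : seq nat, (size sa <= K)%N /\
    forall E n, (m <= E)%N -> J E n -> (n %/ (p ^ f) ^ (E - m))%N \in sa.
  have [sa [saK saP]] := JK m; exists sa; split=> // E n mE Jn.
  by apply: (saP (E - m)%N); apply: word_jump_top.
pose ac := @acc RR (p ^ f) J.
have jac : jumping_numbers A RR `<=` [set x | ac x].
  move=> x [hx _] M.
  have r0 : 0 < ((p ^ f) ^ M)%:R^-1 :> RR by rewrite invr_gt0 ltr0n expn_gt0 q0.
  have [y [[e Me hy] xy]] := hx M Logic.I _ (nbhsx_ballx x _ r0).
  have [n [jn yE]] := list_jump_module hf cR phiP phiE dualE hy.
  exists e.+1, n; split; [exact: leqW|exact: jw|by rewrite -yE].
have acfin : finite_set [set x | ac x] by exact: (acc_finite RR q1 JK').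
have acrat x : ac x -> @rational RR x by exact: (acc_rational q1 Jlt Jlow JK').
have acbd x : ac x -> `|x| < 2 by apply: acc_bounded.
split.
- by apply: finite_near_discrete => t; apply: sub_finite_set acfin => x [/jac].
- by move=> x /jac /acrat.
- apply: finite_near_discrete => t.
  (* A translate z with |t - x| < 1 and |x + z| < 2 satisfies |z| < |t| + 3 <
     M. *)
  pose M := (Num.truncn `|t|).+4.
  pose B : set RR := [set j - (i%:Z - M%:Z)%:~R | j in [set x | ac x] & i in `I_(M + M)].
  apply: (@sub_finite_set _ _ B); last exact: finite_image2 acfin (finite_II _).
  move=> x [[z jz] /= tx]; have zb := acbd _ (jac _ jz).
  have tM : `|t| + 3 < M%:R.
    have -> : M%:R = (Num.truncn `|t|).+1%:R + 3 :> RR by rewrite -natrD addn3.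
    by rewrite ltrD2r truncnS_gt.
  have zM : `|z%:~R| < M%:R :> RR.
    apply: lt_trans tM; rewrite -[z%:~R](addKr x).
    have t1 := ler_norm t; have t2 := ler_norm (- t); rewrite normrN in t2.
    move: zb tx; rewrite ![ `|_| < _]ltr_norml => /andP[? ?] /andP[? ?].
    by apply/andP; split; lra.
  have zM' : (`|z| < M%:Z)%R by rewrite -(ltr_int RR) intr_norm.
  exists (x + z%:~R); first exact: jac.
  exists (absz (z + M%:Z)) => /=; first by lia.
  have -> : absz (z + M%:Z) = z + M%:Z :> int by lia.
  by rewrite addrK addrK.
- move=> x [z /jac/acrat [r _ rE]]; exists (r - z%:~R) => //.
  by rewrite rmorphB /= rE ratr_int addrK.
Qed.
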